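(* Let $k$ be a commutative ring and let $A$ be an associative, unital $k$-algebra equipped with an augmentation $\epsilon: A\to k$ with augmentation ideal $I=\ker\epsilon$. Then $$HS_*(A) = H_*\left(\mathscr{Y}^{epi}_*A;\,k\right) = H_*\left(k[N(-\setminus \mathrm{Epi}\Delta S_+)]\otimes_{\mathrm{Epi}\Delta S_+} B_*^{sym_+}I;\,k\right).$$
   Context: Put $[n]=\{0,1,\dots,n\}$. The category $\Delta S$ has objects $[n]$, $n\ge 0$; a morphism $\alpha:[n]\to[m]$ is a set map together with a total ordering on each fiber $\alpha^{-1}(j)$. Composition: for $\alpha:[n]\to[m]$, $\beta:[m]\to[p]$, the set map is $\beta\alpha$, and in the fiber over $j$ one has $i_1<i_2$ iff either $\alpha(i_1)<\alpha(i_2)$ in the ordering of $\beta^{-1}(j)$, or $\alpha(i_1)=\alpha(i_2)$ and $i_1<i_2$ in the ordering of that fiber of $\alpha$. $\Delta S_+$ is $\Delta S$ with an additional object $[-1]=\emptyset$ and a unique morphism $\iota_n:[-1]\to[n]$ for each $n\ge -1$ (no morphisms $[n]\to[-1]$ for $n\ge0$). $\mathrm{Epi}\Delta S_+$ is the subcategory with the same objects and only the epimorphisms (morphisms whose underlying set map is surjective). $B_*^{sym}A:\Delta S\to k\text{-}\mathbf{Mod}$ is the functor $[n]\mapsto A^{\otimes(n+1)}$ with $\alpha:[n]\to[m]$ sending $a_0\otimes\dots\otimes a_n$ to $b_0\otimes\dots\otimes b_m$, where $b_j$ is the product of the $a_i$, $i\in\alpha^{-1}(j)$, in the given order ($b_j=1_A$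 if the fiber is empty). $B_*^{sym_+}I:\mathrm{Epi}\Delta S_+\to k\text{-}\mathbf{Mod}$ is the functor $[n]\mapsto I^{\otimes(n+1)}$ for $n\ge0$, $[-1]\mapsto k$, with the same formula on morphisms (all fibers are nonempty, and the only epimorphism with source $[-1]$ is the identity). For a small category $\mathscr C$, a contravariant functor $M$ and a covariant functor $N$ from $\mathscr C$ to $k$-modules, $M\otimes_{\mathscr C}N=\bigoplus_X M(X)\otimes_k N(X)$ modulo $y\otimes f_*(x)\approx f^*(y)\otimes x$; $\mathrm{Tor}^{\mathscr C}_*$ denotes its derived functors. The symmetric homology of $A$ is $HS_*(A)=\mathrm{Tor}_*^{\Delta S}(\underline{k},B_*^{sym}A)$, with $\underline{k}$ the constant contravariant functor with value $k$. $N(C\setminus\mathscr C)$ is the nerve of the under-category of $C$, contravariant in $C$; $k[N(-\setminus\mathscr C)]$ is its $k$-linearization, a simplicial contravariant $\mathscr C$-module. $\mathscr{Y}^{epi}_*A:=k[N(-\setminus \mathrm{Epi}\Delta S_+)]\otimes_{\mathrm{Epi}\Delta S_+} B_*^{sym_+}I$. A simplicial $k$-module is regarded as a chain complex with differential the alternating sum of the face maps. *)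

(* Defs.v *)
From HB Require Import structures.
From mathcomp Require Import all_boot all_order all_algebra.
From mathcomp Require Import mathcomp_extra boolp classical_sets functions cardinality fsbigop.

Set Implicit Arguments.
Unset Strict Implicit.
Unset Printing Implicit Defensive.
Import GRing.Theory.
Local Open Scope ring_scope.
Local Open Scope classical_set_scope.
Local Open Scope quotient_scope.

Section Kernel.
Context {k : pzRingType} {V : lmodType k} {W : zmodType} {s : GRing.Scale.law k W}.
Variable f : {linear V -> W | s}.

Definition kerP : {pred V} := [pred v | f v == 0].

Fact kerP_submod : subsemimod_closed kerP.
Proof.
split; first split; rewrite ?inE ?linear0 // => u v; rewrite !inE.
- by move=> /eqP fu /eqP fv; rewrite linearD fu fv addr0.
- by move=> /eqP fv; rewrite linearZ_LR fv -(linear0 f) -linearZ_LR scaler0.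
Qed.

Definition kermod := {v : V | kerP v}.
HB.instance Definition _ := [isSub for (@proj1_sig V kerP) : kermod -> V].
HB.instance Definition _ := [Choice of kermod by <:].
HB.instance Definition _ :=
  GRing.SubChoice_isSubLmodule.Build k V kerP kermod kerP_submod.

Lemma kermodP (v : kermod) : f (val v) = 0.
Proof. by case: v => v /= /eqP. Qed.
End Kernel.

Section Quotient.
Context {k : pzRingType} {V : lmodType k}.

(* The submodule generated by [S]. *)
Inductive submod_span (S : set V) : V -> Prop :=
| span0 : submod_span S 0
| span_lin a u v : S u -> submod_span S v -> submod_span S (a *: u + v).

Lemma spanD S u v : submod_span S u -> submod_span S v -> submod_span S (u + v).
Proof.
move=> + Sv; elim=> [|a x y Sx _ IH]; first by rewrite add0r.
by rewrite -addrA; apply: span_lin.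
Qed.

Lemma spanZ S a u : submod_span S u -> submod_span S (a *: u).
Proof.
elim=> [|b x y Sx _ IH]; first by rewrite scaler0; exact: span0.
by rewrite scalerDr scalerA; apply: span_lin.
Qed.

Lemma spanN S u : submod_span S u -> submod_span S (- u).
Proof. by rewrite -scaleN1r; exact: spanZ. Qed.

Lemma span_in (S : set V) u : S u -> submod_span S u.
Proof. by move=> Su; rewrite -[u]addr0 -[u]scale1r; apply: span_lin => //; exact: span0. Qed.

Variable S : set V.
Definition quot_rel (u v : V) := `[< submod_span S (u - v) >].

Fact quot_relP : equiv_class_of quot_rel.
Proof.
split=> [u|u v|v u w].
- by apply/asboolP; rewrite subrr; exact: span0.
- by apply/asboolP/asboolP => /spanN; rewrite opprB.
- move=> /asboolP uv /asboolP vw; apply/asboolP.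
  by rewrite -(subrK v u) -addrA; exact: spanD.
Qed.
Canonical quot_equiv := EquivRelPack quot_relP.

Definition quot := {eq_quot quot_equiv}.
HB.instance Definition _ := Choice.on quot.
HB.instance Definition _ := EqQuotient.on quot.

Definition quot_pi (u : V) : quot := \pi_quot u.

Lemma quot_piP u v : quot_pi u = quot_pi v <-> submod_span S (u - v).
Proof. by rewrite /quot_pi; split=> [/eqmodP/asboolP|H] //; apply/eqmodP/asboolP. Qed.

Lemma quot_piK (q : quot) : quot_pi (repr q) = q.
Proof. exact: reprK. Qed.

Lemma repr_quot_pi u : submod_span S (repr (quot_pi u) - u).
Proof. by apply/quot_piP; rewrite quot_piK. Qed.

Definition quot_add (p q : quot) := quot_pi (repr p + repr q).
Definition quot_opp (p : quot) := quot_pi (- repr p).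
Definition quot_scale a (p : quot) := quot_pi (a *: repr p).

Lemma quot_addE u v : quot_add (quot_pi u) (quot_pi v) = quot_pi (u + v).
Proof. by apply/quot_piP; rewrite opprD addrACA; apply: spanD; exact: repr_quot_pi. Qed.
Lemma quot_oppE u : quot_opp (quot_pi u) = quot_pi (- u).
Proof. by apply/quot_piP; rewrite -opprD; apply: spanN; exact: repr_quot_pi. Qed.
Lemma quot_scaleE a u : quot_scale a (quot_pi u) = quot_pi (a *: u).
Proof. by apply/quot_piP; rewrite -scalerBr; apply: spanZ; exact: repr_quot_pi. Qed.

Lemma quot_ind (P : quot -> Prop) : (forall u, P (quot_pi u)) -> forall q, P q.
Proof. by move=> Pu q; rewrite -(quot_piK q). Qed.

Fact quot_addA : associative quot_add.
Proof.
by elim/quot_ind=> p; elim/quot_ind=> q; elim/quot_ind=> r; rewrite !quot_addE addrA.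
Qed.
Fact quot_addC : commutative quot_add.
Proof. by elim/quot_ind=> p; elim/quot_ind=> q; rewrite !quot_addE addrC. Qed.
Fact quot_add0 : left_id (quot_pi 0) quot_add.
Proof. by elim/quot_ind=> p; rewrite quot_addE add0r. Qed.
Fact quot_addN : left_inverse (quot_pi 0) quot_opp quot_add.
Proof. by elim/quot_ind=> p; rewrite quot_oppE quot_addE addNr. Qed.
HB.instance Definition _ :=
  GRing.isZmodule.Build quot quot_addA quot_addC quot_add0 quot_addN.

Lemma quot_piD u v : quot_pi (u + v) = quot_pi u + quot_pi v.
Proof. by rewrite -quot_addE. Qed.

Fact quot_scaleA a b (q : quot) : quot_scale a (quot_scale b q) = quot_scale (a * b) q.
Proof. by elim/quot_ind: q => u; rewrite !quot_scaleE scalerA. Qed.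
Fact quot_scale1 : left_id 1 quot_scale.
Proof. by elim/quot_ind=> u; rewrite quot_scaleE scale1r. Qed.
Fact quot_scaleDr : right_distributive quot_scale +%R.
Proof.
by move=> a; elim/quot_ind=> u; elim/quot_ind=> v; rewrite -quot_piD !quot_scaleE scalerDr quot_piD.
Qed.
Fact quot_scaleDl (q : quot) : {morph quot_scale^~ q : a b / a + b}.
Proof. by move=> a b; elim/quot_ind: q => u; rewrite !quot_scaleE scalerDl quot_piD. Qed.
HB.instance Definition _ := GRing.Zmodule_isLmodule.Build k quot
  quot_scaleA quot_scale1 quot_scaleDr quot_scaleDl.

Fact quot_pi_linear : linear quot_pi.
Proof. by move=> a u v; rewrite quot_piD -quot_scaleE. Qed.
HB.instance Definition _ := GRing.isLinear.Build k V quot _ quot_pi quot_pi_linear.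

Definition quot_rec {W : lmodType k} (f : {linear V -> W})
  (fS : forall s, S s -> f s = 0) (q : quot) : W := f (repr q).

Section Rec.
Context {W : lmodType k} (f : {linear V -> W}) (fS : forall s, S s -> f s = 0).
Lemma quot_recE u : quot_rec fS (quot_pi u) = f u.
Proof.
have: submod_span S (repr (quot_pi u) - u) by exact: repr_quot_pi.
rewrite /quot_rec => H; apply/eqP; rewrite -subr_eq0 -linearB; apply/eqP.
by elim: H => [|a x y /fS fx _ fy]; rewrite ?linear0 // linearP fx fy scaler0 addr0.
Qed.
Fact quot_rec_linear : linear (quot_rec fS).
Proof.
by move=> a; elim/quot_ind=> u; elim/quot_ind=> v; rewrite -linearP !quot_recE linearP.
Qed.
HB.instance Definition _ := GRing.isLinear.Build k quot W _ (quot_rec fS) quot_rec_linear.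
End Rec.
End Quotient.
Arguments quot {k V} S.
Arguments quot_pi {k V} S u.

Section DirectSum.
Context {k : pzRingType} {I : Type} (M : I -> lmodType k).
Let cI : choiceType := {classic I}.

Definition dsum_supp (x : forall i, M i) : set cI := [set i | x i != 0].
Definition dsum := {x : forall i, M i | finite_set (dsum_supp x)}.
HB.instance Definition _ := gen_eqMixin dsum.
HB.instance Definition _ := gen_choiceMixin dsum.

Definition dsum_at (x : dsum) : forall i, M i := proj1_sig x.
Lemma dsum_finite x : finite_set (dsum_supp (dsum_at x)).
Proof. by case: x. Qed.
Lemma dsum_ext (x y : dsum) : (forall i, dsum_at x i = dsum_at y i) -> x = y.
Proof.
case: x y => [x px] [y py] /= xy.
have {}xy : x = y by exact: functional_extensionality_dep.
by subst y; rewrite (Prop_irrelevance px py).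
Qed.

Fact dsum0_subproof : finite_set (dsum_supp (fun i => 0)).
Proof.
apply: (@sub_finite_set _ _ set0) (@finite_set0 _) => i.
by rewrite /dsum_supp /= eqxx.
Qed.
Definition dsum0 : dsum := exist _ (fun i => 0) dsum0_subproof.

Fact dsum_add_subproof (x y : dsum) :
  finite_set (dsum_supp (fun i => dsum_at x i + dsum_at y i)).
Proof.
apply: (@sub_finite_set _ _ (dsum_supp (dsum_at x) `|` dsum_supp (dsum_at y))).
  move=> i; rewrite /dsum_supp /= => H; apply/orP; rewrite -negb_and; apply: contra H.
  by move=> /andP[/eqP -> /eqP ->]; rewrite addr0.
by rewrite finite_setU; split; exact: dsum_finite.
Qed.
Definition dsum_add x y : dsum :=
  exist _ (fun i => dsum_at x i + dsum_at y i) (dsum_add_subproof x y).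

Fact dsum_scale_subproof a (x : dsum) :
  finite_set (dsum_supp (fun i => a *: dsum_at x i)).
Proof.
apply: (@sub_finite_set _ _ (dsum_supp (dsum_at x))); last exact: dsum_finite.
by move=> i; rewrite /dsum_supp /=; apply: contra => /eqP ->; rewrite scaler0.
Qed.
Definition dsum_scale a x : dsum :=
  exist _ (fun i => a *: dsum_at x i) (dsum_scale_subproof a x).

Fact dsum_addA : associative dsum_add.
Proof. by move=> x y z; apply: dsum_ext => i /=; rewrite addrA. Qed.
Fact dsum_addC : commutative dsum_add.
Proof. by move=> x y; apply: dsum_ext => i /=; rewrite addrC. Qed.
Fact dsum_add0 : left_id dsum0 dsum_add.
Proof. by move=> x; apply: dsum_ext => i /=; rewrite add0r. Qed.
Fact dsum_addN : left_inverse dsum0 (dsum_scale (-1)) dsum_add.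
Proof. by move=> x; apply: dsum_ext => i /=; rewrite scaleN1r addNr. Qed.
HB.instance Definition _ :=
  GRing.isZmodule.Build dsum dsum_addA dsum_addC dsum_add0 dsum_addN.

Fact dsum_scaleA a b (x : dsum) : dsum_scale a (dsum_scale b x) = dsum_scale (a * b) x.
Proof. by apply: dsum_ext => i /=; rewrite scalerA. Qed.
Fact dsum_scale1 : left_id 1 dsum_scale.
Proof. by move=> x; apply: dsum_ext => i /=; rewrite scale1r. Qed.
Fact dsum_scaleDr : right_distributive dsum_scale +%R.
Proof. by move=> a x y; apply: dsum_ext => i /=; rewrite scalerDr. Qed.
Fact dsum_scaleDl (x : dsum) : {morph dsum_scale^~ x : a b / a + b}.
Proof. by move=> a b; apply: dsum_ext => i /=; rewrite scalerDl. Qed.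
HB.instance Definition _ := GRing.Zmodule_isLmodule.Build k dsum
  dsum_scaleA dsum_scale1 dsum_scaleDr dsum_scaleDl.

Lemma dsum_at_linear i a (x y : dsum) :
  dsum_at (a *: x + y) i = a *: dsum_at x i + dsum_at y i.
Proof. by []. Qed.

Definition dsum_in_fun i (m : M i) (j : I) : M j :=
  if pselect (i = j) is left e then ecast j (M j) e m else 0.
Lemma dsum_in_funE i m : @dsum_in_fun i m i = m.
Proof. by rewrite /dsum_in_fun; case: pselect => // e; rewrite (Prop_irrelevance e erefl). Qed.
Lemma dsum_in_fun_neq i m j : i <> j -> @dsum_in_fun i m j = 0.
Proof. by rewrite /dsum_in_fun; case: pselect. Qed.
Fact dsum_in_subproof i (m : M i) : finite_set (dsum_supp (dsum_in_fun m)).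
Proof.
apply: (@sub_finite_set _ _ [set i : cI]); last exact: finite_set1.
move=> j; rewrite /dsum_supp /= => H; apply: contrapT => ij; move: H.
by rewrite dsum_in_fun_neq ?eqxx // => ji; apply: ij.
Qed.
Definition dsum_in i (m : M i) : dsum := exist _ (dsum_in_fun m) (dsum_in_subproof m).
Fact dsum_in_linear i : linear (@dsum_in i).
Proof.
move=> a x y; apply: dsum_ext => j; rewrite dsum_at_linear /=.
case: (pselect (i = j)) => [<-|ij]; first by rewrite !dsum_in_funE.
by rewrite !dsum_in_fun_neq // scaler0 addr0.
Qed.
HB.instance Definition _ i :=
  GRing.isLinear.Build k (M i) dsum _ (@dsum_in i) (@dsum_in_linear i).

Section Rec.
Context {W : lmodType k} (f : forall i, {linear M i -> W}).
Definition dsum_rec (x : dsum) : W :=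
  \sum_(i \in [set: cI]) f i (dsum_at x i).

Lemma dsum_rec_on (A : set cI) x : finite_set A -> dsum_supp (dsum_at x) `<=` A ->
  dsum_rec x = \sum_(i \in A) f i (dsum_at x i).
Proof.
move=> finA sA; rewrite /dsum_rec; symmetry; apply: fsbig_widen => // i [_ nAi] /=.
case: (eqVneq (dsum_at x i) 0) => [->|H]; first by rewrite linear0.
by case: nAi; apply: sA.
Qed.

Fact dsum_rec_linear : linear dsum_rec.
Proof.
move=> a x y.
pose A := dsum_supp (dsum_at x) `|` dsum_supp (dsum_at y).
have finA : finite_set A by rewrite finite_setU; split; exact: dsum_finite.
rewrite !(@dsum_rec_on A) //; first last.
- move=> i; rewrite /dsum_supp /= => H; apply/orP; rewrite -negb_and; apply: contra H.
  by move=> /andP[/eqP -> /eqP ->]; rewrite scaler0 addr0.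
- by move=> i ?; left.
- by move=> i ?; right.
rewrite !fsbig_finite // scaler_sumr -big_split /=.
by apply: eq_bigr => i _; rewrite linearP.
Qed.
HB.instance Definition _ := GRing.isLinear.Build k dsum W _ dsum_rec dsum_rec_linear.

Lemma dsum_recE i (m : M i) : dsum_rec (dsum_in m) = f i m.
Proof.
rewrite (@dsum_rec_on [set i : cI]); [|exact: finite_set1|].
  by rewrite fsbig_set1 /= dsum_in_funE.
move=> j; rewrite /dsum_supp /= => H; apply: contrapT => ij; move: H.
by rewrite dsum_in_fun_neq ?eqxx // => ji; apply: ij.
Qed.
End Rec.

Lemma dsum_hom_ext (W : lmodType k) (f g : {linear dsum -> W}) :
  (forall i (m : M i), f (dsum_in m) = g (dsum_in m)) -> f =1 g.
Proof.
move=> fg x.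
have -> : x = dsum_rec (fun i => @dsum_in i : {linear M i -> dsum}) x.
  apply: dsum_ext => j.
  have -> : dsum_at (dsum_rec (fun i => @dsum_in i : {linear M i -> dsum}) x) j =
     \sum_(i <- finmap.enum_fset (fset_set (dsum_supp (dsum_at x))))
       dsum_at (dsum_in (dsum_at x i)) j.
    rewrite (dsum_rec_on _ (dsum_finite x)) // fsbig_finite; last exact: dsum_finite.
    by elim/big_rec2: _ => // i y1 y2 _ <-.
  rewrite -fsbig_finite; last exact: dsum_finite.
  rewrite (@fsbig_widen _ _ _ _ _ setT) //=; last first.
    move=> i [_] /= /negP; rewrite negbK => /eqP ->.
    by rewrite /dsum_in_fun; case: pselect => // e; case: _ / e.
  rewrite -(@fsbig_widen _ _ _ _ [set j : cI]) //=.
    by rewrite fsbig_set1 dsum_in_funE.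
  by move=> i [_] /= ij; rewrite dsum_in_fun_neq.
rewrite (dsum_rec_on _ (dsum_finite x)) // fsbig_finite; last exact: dsum_finite.
by rewrite !linear_sum; apply: eq_bigr => i _; exact: fg.
Qed.
End DirectSum.
Arguments dsum_in {k I} M i m.

Lemma quot_hom_ext (k : pzRingType) (V W : lmodType k) (S : set V)
    (f g : {linear quot S -> W}) :
  (forall v, f (quot_pi S v) = g (quot_pi S v)) -> f =1 g.
Proof. by move=> fg q; rewrite -(quot_piK q). Qed.

Section FreeModule.
Context {k : pzRingType} {T : Type}.

Definition freemod : lmodType k := dsum (fun _ : T => k^o).
Definition free_gen (t : T) : freemod := dsum_in (fun _ : T => k^o) t 1.

Section Rec.
Context {W : lmodType k}.
Definition scale_at (w : W) (a : k^o) : W := (a : k) *: w.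
Fact scale_at_linear w : linear (scale_at w).
Proof. by move=> a x y; rewrite /scale_at scalerDl scalerA. Qed.
HB.instance Definition _ w :=
  GRing.isLinear.Build k k^o W _ (scale_at w) (scale_at_linear w).

Definition free_rec (f : T -> W) : {linear freemod -> W} :=
  dsum_rec (fun t => scale_at (f t) : {linear k^o -> W}).

Lemma free_recE f t : free_rec f (free_gen t) = f t.
Proof. by rewrite /free_rec /free_gen /= dsum_recE /= /scale_at scale1r. Qed.
End Rec.

Lemma free_hom_ext (W : lmodType k) (f g : {linear freemod -> W}) :
  (forall t, f (free_gen t) = g (free_gen t)) -> f =1 g.
Proof.
move=> fg; apply: dsum_hom_ext => t a.
have -> : dsum_in (fun _ : T => k^o) t a = (a : k) *: free_gen t.
  by rewrite /free_gen -linearZ /=; congr dsum_in; rewrite /GRing.scale /= mulr1.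
by rewrite !linearZ fg.
Qed.
End FreeModule.
Arguments freemod k T : clear implicits.

Definition free_map {k : pzRingType} {S T : Type} (f : S -> T) :
  {linear freemod k S -> freemod k T} := free_rec (fun s => free_gen (f s)).

Section Tensor.
Context {k : comPzRingType} (M N : lmodType k).

Definition tens_rel : set (freemod k (M * N)) :=
  [set z | (exists a x x' y, z = free_gen (a *: x + x', y)
                               - (a *: free_gen (x, y) + free_gen (x', y)))
        \/ (exists a x y y', z = free_gen (x, a *: y + y')
                               - (a *: free_gen (x, y) + free_gen (x, y')))].

Definition tens : lmodType k := quot tens_rel.
Definition pure (x : M) (y : N) : tens := quot_pi tens_rel (free_gen (x, y)).

Fact pure_linearl y : linear (pure^~ y).
Proof.
move=> a x x'; rewrite /pure -linearP; apply/quot_piP/span_in.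
by left; exists a, x, x', y.
Qed.
Fact pure_linearr x : linear (pure x).
Proof.
move=> a y y'; rewrite /pure -linearP; apply/quot_piP/span_in.
by right; exists a, x, y, y'.
Qed.

Section Rec.
Context {W : lmodType k} (b : M -> N -> W).
Hypotheses (bl : forall y, linear (b^~ y)) (br : forall x, linear (b x)).
Fact tens_rec_subproof z : tens_rel z -> free_rec (fun p => b p.1 p.2) z = 0.
Proof.
case=> [[a [x [x' [y ->]]]]|[a [x [y [y' ->]]]]];
  rewrite linearB linearP !free_recE /=; apply/eqP; rewrite subr_eq0; apply/eqP.
  exact: bl.
exact: br.
Qed.
Definition tens_rec : {linear tens -> W} := quot_rec tens_rec_subproof.
Lemma tens_recE x y : tens_rec (pure x y) = b x y.
Proof. exact: etrans (quot_recE _ _) (free_recE _ _). Qed.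
End Rec.

Lemma tens_hom_ext (W : lmodType k) (f g : {linear tens -> W}) :
  (forall x y, f (pure x y) = g (pure x y)) -> f =1 g.
Proof.
move=> fg; apply: quot_hom_ext.
by apply: (@free_hom_ext k _ W (f \o quot_pi tens_rel) (g \o quot_pi tens_rel)) => -[x y]; exact: fg.
Qed.
End Tensor.
Arguments pure {k M N} x y.
Arguments tens_rec {k M N W b} bl br.

Section TensorPower.
Context {k : comPzRingType} (V : lmodType k) (n : nat).

Definition multilinear (W : lmodType k) (f : ('I_n -> V) -> W) :=
  forall i a x y z, (forall j, j != i -> x j = y j /\ x j = z j) ->
    x i = a *: y i + z i -> f x = a *: f y + f z.

Definition tpow_rel : set (freemod k ('I_n -> V)) :=
  [set t | exists i a x y z, [/\ forall j, j != i -> x j = y j /\ x j = z j,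
    x i = a *: y i + z i & t = free_gen x - (a *: free_gen y + free_gen z)]].

(* [V] to the [n]-th tensor power; for [n = 0] there is no relation and this is
   the free module on the empty tensor, i.e. [k]. *)
Definition tpow : lmodType k := quot tpow_rel.
Definition tpure (x : 'I_n -> V) : tpow := quot_pi tpow_rel (free_gen x).

Fact tpure_multilinear : multilinear tpure.
Proof.
move=> i a x y z xyz xi; rewrite /tpure -linearP; apply/quot_piP/span_in.
by exists i, a, x, y, z.
Qed.

Section Rec.
Context {W : lmodType k} (f : ('I_n -> V) -> W) (fM : multilinear f).
Fact tpow_rec_subproof t : tpow_rel t -> free_rec f t = 0.
Proof.
case=> i [a [x [y [z [xyz xi ->]]]]]; rewrite linearB linearP !free_recE.
by rewrite (fM xyz xi) subrr.
Qed.
Definition tpow_rec : {linear tpow -> W} := quot_rec tpow_rec_subproof.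
Lemma tpow_recE x : tpow_rec (tpure x) = f x.
Proof. exact: etrans (quot_recE _ _) (free_recE _ _). Qed.
End Rec.

Lemma tpow_hom_ext (W : lmodType k) (f g : {linear tpow -> W}) :
  (forall x, f (tpure x) = g (tpure x)) -> f =1 g.
Proof.
move=> fg; apply: quot_hom_ext.
exact: (@free_hom_ext k _ W (f \o quot_pi tpow_rel) (g \o quot_pi tpow_rel)).
Qed.
End TensorPower.

Record category := Category {
  obj :> Type;
  mor : obj -> obj -> Type;
  idc : forall X, mor X X;
  compc : forall X Y Z, mor Y Z -> mor X Y -> mor X Z;
  comp1c : forall X Y (f : mor X Y), compc (idc Y) f = f;
  compc1 : forall X Y (f : mor X Y), compc f (idc X) = f;
  compcA : forall X Y Z T (h : mor Z T) (g : mor Y Z) (f : mor X Y),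
    compc h (compc g f) = compc (compc h g) f }.
Arguments mor {c} X Y.
Arguments idc {c} X.
Arguments compc {c X Y Z} g f.
Notation "g \oc f" := (compc g f) (at level 40, left associativity).

Definition opposite (C : category) : category :=
  @Category C (fun X Y => mor Y X) (@idc C) (fun X Y Z g f => f \oc g)
    (fun X Y f => compc1 f) (fun X Y f => comp1c f)
    (fun X Y Z T h g f => esym (compcA f g h)).

Record functor (C D : category) := Functor {
  fobj :> C -> D;
  fmap : forall X Y, mor X Y -> mor (fobj X) (fobj Y);
  fmap_id : forall X, fmap (idc X) = idc (fobj X);
  fmap_comp : forall X Y Z (g : mor Y Z) (f : mor X Y), fmap (g \oc f) = fmap g \oc fmap f }.
Arguments fmap {C D} F {X Y} f : rename.

(* Functors to [k]-modules; contravariant ones are functors on [opposite C]. *)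
Section KFunctors.
Context {k : pzRingType}.

Record kfunctor (C : category) := KFunctor {
  kobj :> C -> lmodType k;
  kmap : forall X Y, mor X Y -> {linear kobj X -> kobj Y};
  kmap_id : forall X x, kmap (idc X) x = x;
  kmap_comp : forall X Y Z (g : mor Y Z) (f : mor X Y) x,
    kmap (g \oc f) x = kmap g (kmap f x) }.
Arguments kmap {C} M {X Y} f : rename.

Record ktrans (C : category) (M N : kfunctor C) := KTrans {
  kcomp :> forall X, {linear M X -> N X};
  kcomp_nat : forall X Y (f : mor X Y) x, kcomp Y (kmap M f x) = kmap N f (kcomp X x) }.

Definition kconst (C : category) (V : lmodType k) : kfunctor C :=
  @KFunctor C (fun _ => V) (fun _ _ _ => idfun) (fun _ _ => erefl) (fun _ _ _ _ _ _ => erefl).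
End KFunctors.
Arguments kfunctor k C : clear implicits.
Arguments kmap {k C} M {X Y} f : rename.

Section TensorOverCategory.
Context {k : comPzRingType} {C : category}.

Section Def.
Variables (M : kfunctor k (opposite C)) (N : kfunctor k C).
Let S := dsum (fun X : C => tens (M X) (N X)).
Definition tensC_in (X : C) (y : M X) (x : N X) : S :=
  dsum_in (fun X : C => tens (M X) (N X)) X (pure y x).

Definition tensC_rel : set S :=
  [set z | exists (X Y : C) (f : mor X Y) (y : M Y) (x : N X),
     z = tensC_in y (kmap N f x) - tensC_in (kmap M (f : @mor (opposite C) Y X) y) x].
Definition tensC : lmodType k := quot tensC_rel.
Definition pureC X (y : M X) (x : N X) : tensC := quot_pi tensC_rel (tensC_in y x).

Lemma pureC_bal (X Y : C) (f : mor X Y) (y : M Y) (x : N X) :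
  pureC y (kmap N f x) = pureC (kmap M (f : @mor (opposite C) Y X) y) x.
Proof. by apply/quot_piP/span_in; exists X, Y, f, y, x. Qed.
Lemma pureC_linearl X (x : N X) : linear ((@pureC X)^~ x).
Proof. by move=> a y y'; rewrite /pureC /tensC_in pure_linearl !linearP. Qed.
Lemma pureC_linearr X (y : M X) : linear (@pureC X y).
Proof. by move=> a x x'; rewrite /pureC /tensC_in pure_linearr !linearP. Qed.

Lemma pureC0l X (x : N X) : @pureC X 0 x = 0.
Proof.
by have := pureC_linearl x (-1) 0 0; rewrite scaler0 addr0 scaleN1r addNr.
Qed.

Section Rec.
Context {W : lmodType k} (b : forall X, M X -> N X -> W).
Hypotheses (bl : forall X x, linear ((b (X := X))^~ x)) (br : forall X y, linear (b (X := X) y)).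
Hypothesis bb : forall (X Y : C) (f : mor X Y) (y : M Y) (x : N X),
  b y (kmap N f x) = b (kmap M (f : @mor (opposite C) Y X) y) x.
Let r : {linear S -> W} := dsum_rec (fun X => tens_rec (@bl X) (@br X)).
Let rE X (y : M X) (x : N X) : r (tensC_in y x) = b y x.
Proof. by rewrite /r /tensC_in /= dsum_recE tens_recE. Qed.
Fact tensC_rec_subproof z : tensC_rel z -> r z = 0.
Proof. by case=> X [Y [f [y [x ->]]]]; rewrite linearB !rE bb subrr. Qed.
Definition tensC_rec : {linear tensC -> W} := quot_rec tensC_rec_subproof.
Lemma tensC_recE X (y : M X) (x : N X) : tensC_rec (pureC y x) = b y x.
Proof. exact: etrans (quot_recE _ _) (rE _ _). Qed.
End Rec.

Lemma tensC_hom_ext (W : lmodType k) (f g : {linear tensC -> W}) :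
  (forall X (y : M X) (x : N X), f (pureC y x) = g (pureC y x)) -> f =1 g.
Proof.
move=> fg; apply: quot_hom_ext.
apply: (@dsum_hom_ext k _ _ W (f \o quot_pi tensC_rel) (g \o quot_pi tensC_rel)) => X t.
pose F := fun X : C => tens (M X) (N X).
pose i : {linear F X -> dsum F} := dsum_in F X.
pose p : {linear dsum F -> tensC} := quot_pi tensC_rel.
pose h (e : {linear tensC -> W}) : {linear F X -> W} := e \o (p \o i).
suff: h f t = h g t by [].
apply: tens_hom_ext => y x.
exact: fg.
Qed.
End Def.

Section Map.
Context {M M' : kfunctor k (opposite C)} (N : kfunctor k C) (phi : ktrans M M').
Let b X (y : M X) (x : N X) : tensC M' N := pureC (phi X y) x.
Let bl X x : linear ((@b X)^~ x).
Proof. by move=> a y y'; rewrite /b linearP pureC_linearl. Qed.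
Let br X y : linear (@b X y).
Proof. by move=> a x x'; rewrite /b pureC_linearr. Qed.
Let bb (X Y : C) (f : mor X Y) (y : M Y) (x : N X) :
  b y (kmap N f x) = b (kmap M (f : @mor (opposite C) Y X) y) x.
Proof. by rewrite /b pureC_bal; congr pureC; rewrite kcomp_nat. Qed.
Definition tensC_map : {linear tensC M N -> tensC M' N} := tensC_rec bl br bb.
Lemma tensC_mapE X (y : M X) (x : N X) : tensC_map (pureC y x) = pureC (phi X y) x.
Proof. exact: tensC_recE. Qed.
End Map.
End TensorOverCategory.

(* Chain complexes in nonnegative degrees. *)
Record kcomplex (k : pzRingType) := KComplex {
  cx :> nat -> lmodType k;
  cx_d : forall n, {linear cx n.+1 -> cx n};
  cx_dd : forall n x, cx_d n (cx_d n.+1 x) = 0 }.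
Arguments cx_d {k} C n : rename.

Section Homology.
Context {k : pzRingType} (C : kcomplex k).
(* The differential out of degree [n], which is zero for [n = 0]. *)
Definition cx_out (n : nat) : {linear C n -> C n.-1} :=
  match n with 0 => \0 | m.+1 => cx_d C m end.
Definition cx_boundary (n : nat) : set (kermod (cx_out n)) :=
  [set z | exists y : C n.+1, val z = cx_d C n y].
Definition homology (n : nat) : lmodType k := quot (@cx_boundary n).
End Homology.

Section Resolutions.
Context {k : pzRingType} {C : category}.

Definition kepi (M N : kfunctor k C) (p : ktrans M N) :=
  forall X (y : N X), exists x, p X x = y.

Definition kprojective (P : kfunctor k C) :=
  forall (M N : kfunctor k C) (p : ktrans M N) (f : ktrans P N), kepi p ->
    exists g : ktrans P M, forall X x, p X (g X x) = f X x.

Record resolution (M : kfunctor k C) := Resolution {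
  res :> nat -> kfunctor k C;
  res_d : forall n, ktrans (res n.+1) (res n);
  res_aug : ktrans (res 0) M;
  res_projective : forall n, kprojective (res n);
  res_epi : kepi res_aug;
  res_exact0 : forall X x, res_aug X x = 0 <-> exists y, x = res_d 0 X y;
  res_exact : forall n X x, res_d n X x = 0 <-> exists y, x = res_d n.+1 X y }.

Section Kernel.
Context {M N : kfunctor k C} (phi : ktrans M N).
Definition kker_fun X Y (f : mor X Y) (z : kermod (phi X)) : kermod (phi Y).
Proof.
exists (kmap M f (val z)).
abstract by rewrite /kerP inE kcomp_nat (kermodP z) raddf0.
Defined.
Fact kker_fun_linear X Y (f : mor X Y) : linear (@kker_fun X Y f).
Proof. by move=> a x y; apply: val_inj; rewrite /= !linearP. Qed.
HB.instance Definition _ X Y (f : mor X Y) :=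
  GRing.isLinear.Build k _ _ _ (@kker_fun X Y f) (@kker_fun_linear X Y f).
Fact kker_id X (z : kermod (phi X)) : kker_fun (idc X) z = z.
Proof. by apply: val_inj; rewrite /= kmap_id. Qed.
Fact kker_comp X Y Z (g : mor Y Z) (f : mor X Y) (z : kermod (phi X)) :
  kker_fun (g \oc f) z = kker_fun g (kker_fun f z).
Proof. by apply: val_inj; rewrite /= kmap_comp. Qed.
Definition kker : kfunctor k C := @KFunctor k C (fun X => kermod (phi X))
  (fun X Y f => @kker_fun X Y f) kker_id kker_comp.
Definition kker_incl : ktrans kker M :=
  @KTrans k C kker M (fun X => val : {linear kermod (phi X) -> M X})
    (fun _ _ _ _ => erefl).
End Kernel.

Definition ktrans_comp (M N P : kfunctor k C) (psi : ktrans N P) (phi : ktrans M N) :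
  ktrans M P.
Proof.
exists (fun X => psi X \o phi X).
abstract by move=> X Y f x /=; rewrite !kcomp_nat.
Defined.

(* The sum of the representable functors [k[mor Y -]] over all [Y] and [m \in M Y]. *)
Section Cover.
Variable M : kfunctor k C.
Definition cover_gen (X : C) := {Y : C & (mor Y X * M Y)%type}.
Definition cover_act X X' (g : mor X X') (t : cover_gen X) : cover_gen X' :=
  let: existT Y (f, m) := t in existT _ Y (g \oc f, m).
Fact cover_id X (x : freemod k (cover_gen X)) : free_map (cover_act (idc X)) x = x.
Proof.
apply: (@free_hom_ext k _ _ (free_map (cover_act (idc X))) idfun) => -[Y [f m]].
by rewrite free_recE /= comp1c.
Qed.
Fact cover_comp X Y Z (g : mor Y Z) (f : mor X Y) (x : freemod k (cover_gen X)) :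
  free_map (cover_act (g \oc f)) x = free_map (cover_act g) (free_map (cover_act f) x).
Proof.
apply: (@free_hom_ext k _ _ (free_map (cover_act (g \oc f)))
  (free_map (cover_act g) \o free_map (cover_act f))) => -[T [h m]].
by rewrite /= !free_recE /= compcA.
Qed.
Definition cover : kfunctor k C := @KFunctor k C (fun X => freemod k (cover_gen X))
  (fun X Y f => free_map (cover_act f)) cover_id cover_comp.

Definition cover_val X (t : cover_gen X) : M X :=
  let: existT Y (f, m) := t in kmap M f m.
Fact cover_val_nat X Y (f : mor X Y) (x : cover X) :
  free_rec (@cover_val Y) (kmap cover f x) = kmap M f (free_rec (@cover_val X) x).
Proof.
apply: (@free_hom_ext k _ _ (free_rec (@cover_val Y) \o kmap cover f)
  (kmap M f \o free_rec (@cover_val X))) => -[T [h m]].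
by rewrite /= !free_recE /= kmap_comp.
Qed.
Definition cover_ev : ktrans cover M :=
  @KTrans k C cover M (fun X => free_rec (@cover_val X)) cover_val_nat.

Lemma cover_ev_epi : kepi cover_ev.
Proof.
move=> X m; exists (free_gen (existT _ X (idc X, m))).
by rewrite free_recE /= kmap_id.
Qed.

Lemma cover_projective : kprojective cover.
Proof.
move=> A B p f p_epi.
pose u Y (m : M Y) := f Y (free_gen (existT _ Y (idc Y, m))).
pose v Y (m : M Y) := xget 0 [set x | p Y x = u Y m].
have pv Y m : p Y (v Y m) = u Y m.
  by rewrite /v; case: xgetP => [x _ //|]; have [x px] := p_epi Y (u Y m); move=> /(_ x).
pose g0 X (t : cover_gen X) : A X := let: existT Y (h, m) := t in kmap A h (v Y m).
have g0_nat X Y (h : mor X Y) (x : cover X) :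
    free_rec (@g0 Y) (kmap cover h x) = kmap A h (free_rec (@g0 X) x).
  apply: (@free_hom_ext k _ _ (free_rec (@g0 Y) \o kmap cover h)
    (kmap A h \o free_rec (@g0 X))) => -[T [h' m]].
  by rewrite /= !free_recE /= kmap_comp.
exists (@KTrans k C cover A (fun X => free_rec (@g0 X)) g0_nat) => X x.
apply: (@free_hom_ext k _ _ (p X \o free_rec (@g0 X)) (f X)) => -[Y [h m]].
rewrite /= !free_recE /= kcomp_nat pv /u -kcomp_nat /=; congr (f X _).
by rewrite free_recE /= compc1.
Qed.
End Cover.

(* The resolution obtained by iterating [cover]: [P_0 = cover M], [P_n.+1 = cover K_n]
   with [K_n] the kernel of the preceding map. *)
Section StdResolution.
Variable M : kfunctor k C.
Fixpoint syzygy (n : nat) : kfunctor k C :=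
  if n is m.+1 then kker (cover_ev (syzygy m)) else M.
Definition std_d n : ktrans (cover (syzygy n.+1)) (cover (syzygy n)) :=
  ktrans_comp (kker_incl (cover_ev (syzygy n))) (cover_ev (syzygy n.+1)).

Lemma std_exact n X (x : cover (syzygy n) X) :
  cover_ev (syzygy n) X x = 0 <-> exists y, x = std_d n X y.
Proof.
split=> [x0|[y ->]]; last exact: (kermodP (cover_ev (syzygy n.+1) X y)).
have xK : kerP (cover_ev (syzygy n) X) x by apply/eqP.
have [y yx] := @cover_ev_epi (syzygy n.+1) X (exist _ x xK).
by exists y; rewrite /= yx.
Qed.

Lemma std_exactS n X (x : cover (syzygy n.+1) X) :
  std_d n X x = 0 <-> exists y, x = std_d n.+1 X y.
Proof.
rewrite -std_exact; split=> [x0|x0]; last by rewrite /std_d /= x0.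
by apply: val_inj; exact: x0.
Qed.

Definition std_resolution : resolution M :=
  @Resolution M (fun n => cover (syzygy n)) std_d (cover_ev M)
    (fun n => @cover_projective _) (@cover_ev_epi M) (@std_exact 0) std_exactS.
End StdResolution.
End Resolutions.

Section Tor.
Context {k : comPzRingType} {C : category}.
Variables (M : kfunctor k (opposite C)) (N : kfunctor k C).

Fact tor_dd (P : resolution M) n (x : tensC (P n.+2) N) :
  tensC_map N (res_d P n) (tensC_map N (res_d P n.+1) x) = 0.
Proof.
apply: (@tensC_hom_ext k C _ _ _ (tensC_map N (res_d P n) \o tensC_map N (res_d P n.+1)) \0).
move=> X y z.
change (tensC_map N (res_d P n) (tensC_map N (res_d P n.+1) (pureC y z)) = 0).
rewrite !tensC_mapE.
suff -> : res_d P n X (res_d P n.+1 X y) = 0 by exact: pureC0l.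
by apply/res_exact; exists y.
Qed.
Definition tor_complex (P : resolution M) : kcomplex k :=
  @KComplex k (fun n => tensC (P n) N) (fun n => tensC_map N (res_d P n)) (@tor_dd P).
(* The left derived functors of [- (x)_C N], evaluated on a chosen projective
   resolution of [M]; up to isomorphism they do not depend on the choice. *)
Definition Tor (n : nat) : lmodType k := homology (tor_complex (std_resolution M)) n.
End Tor.

Section Nerve.
Variable D : category.

(* Chains [X -> X_1 -> ... -> X_n] of composable morphisms starting at [X]. *)
Fixpoint chain (n : nat) (X : D) : Type :=
  if n is m.+1 then {Y : D & (mor X Y * chain m Y)%type} else unit.

Definition nerve (n : nat) := {X : D & chain n X}.

(* [chain_face i] removes the vertex [X_i.+1], composing the two adjacent arrows
   if it is not the last one. *)
Fixpoint chain_face (n i : nat) : forall X : D, chain n.+1 X -> chain n X :=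
  match n return forall X : D, chain n.+1 X -> chain n X with
  | 0 => fun _ _ => tt
  | m.+1 => fun X c =>
      let: existT Y (f, c1) := c in
      match i with
      | 0 => let: existT Z (g, c2) := c1 in existT _ Z (g \oc f, c2)
      | j.+1 => existT _ Y (f, chain_face j c1)
      end
  end.

(* The face maps [d_0, ..., d_n.+1]; the index [i] is only meaningful for
   [i <= n.+1]. *)
Definition nerve_face (n i : nat) (s : nerve n.+1) : nerve n :=
  match i with
  | 0 => let: existT X (existT Y (f, c)) := s in existT _ Y c
  | j.+1 => let: existT X c := s in existT _ X (chain_face j c)
  end.

Lemma chain_face_face n i j (X : D) (c : chain n.+2 X) :
  (i < j)%N -> (j <= n.+1)%N ->
  chain_face i (chain_face j c) = chain_face j.-1 (chain_face i c).
Proof.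
elim: n i j X c => [//|n IH] i [//|j] X [Y [f [Z [g [T [h c]]]]]] ij jn.
case: i ij => [|i] ij.
  case: j ij jn => [|j] ij jn; last by [].
  by case: n IH c jn => [|n] IH c jn /=; rewrite compcA.
rewrite /=.
case: j ij jn => [//|j] ij jn.
congr existT; congr pair.
exact: (IH i j.+1 Y (existT _ Z (g, existT _ T (h, c)))).
Qed.

Lemma nerve_face_face n i j (s : nerve n.+2) :
  (i < j)%N -> (j <= n.+2)%N ->
  nerve_face i (nerve_face j s) = nerve_face j.-1 (nerve_face i s).
Proof.
case: s => X [Y [f [Z [g c]]]].
case: j => [//|j]; case: i => [|i] ij jn.
  by case: j {ij} jn => [|j] jn.
case: j ij jn => [//|j] ij jn.
exact: (f_equal (existT _ X) (@chain_face_face n i j.+1 X _ ij jn)).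
Qed.
End Nerve.

Fixpoint chain_map (D E : category) (F : functor D E) (n : nat) :
    forall X : D, chain n X -> chain n (F X) :=
  match n return forall X : D, chain n X -> chain n (F X) with
  | 0 => fun _ _ => tt
  | m.+1 => fun X c =>
      let: existT Y (f, c1) := c in existT _ (F Y) (fmap F f, chain_map F c1)
  end.

Definition nerve_map (D E : category) (F : functor D E) (n : nat)
    (s : nerve D n) : nerve E n :=
  let: existT X c := s in existT _ (F X) (chain_map F c).

Lemma chain_map_face (D E : category) (F : functor D E) n i (X : D) (c : chain n.+1 X) :
  chain_map F (chain_face i c) = chain_face i (chain_map F c).
Proof.
elim: n i X c => [//|n IH] [|i] X [Y [f [Z [g c]]]] /=; first by rewrite fmap_comp.
by congr existT; congr pair; exact: (IH i Y (existT _ Z (g, c))).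
Qed.

Lemma nerve_map_face (D E : category) (F : functor D E) n i (s : nerve D n.+1) :
  nerve_map F (nerve_face i s) = nerve_face i (nerve_map F s).
Proof.
case: s => X c; case: i => [|i]; first by case: c => Y [f c].
by rewrite /= chain_map_face.
Qed.

Set Primitive Projections.
Record under_obj (C : category) (X : C) := UnderObj {
  und_cod : C;
  und_arr : mor X und_cod }.
Unset Primitive Projections.

Section Under.
Context {C : category}.

Definition under_hom (X : C) (a b : under_obj X) :=
  {g : mor (und_cod a) (und_cod b) | g \oc und_arr a = und_arr b}.

Lemma under_hom_ext (X : C) (a b : under_obj X) (f g : under_hom a b) :
  sval f = sval g -> f = g.
Proof. by case: f g => f pf [g pg] /= fg; subst g; rewrite (Prop_irrelevance pf pg). Qed.

Definition under_id (X : C) (a : under_obj X) : under_hom a a :=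
  exist _ (idc (und_cod a)) (comp1c (und_arr a)).

Fact under_comp_subproof (X : C) (a b c : under_obj X) (g : under_hom b c)
  (f : under_hom a b) : sval g \oc sval f \oc und_arr a = und_arr c.
Proof. by rewrite -compcA (svalP f) (svalP g). Qed.
Definition under_comp (X : C) (a b c : under_obj X) (g : under_hom b c)
  (f : under_hom a b) : under_hom a c := exist _ _ (under_comp_subproof g f).

Fact under_comp1c (X : C) (a b : under_obj X) (f : under_hom a b) :
  under_comp (under_id b) f = f.
Proof. by apply: under_hom_ext; rewrite /= comp1c. Qed.
Fact under_compc1 (X : C) (a b : under_obj X) (f : under_hom a b) :
  under_comp f (under_id a) = f.
Proof. by apply: under_hom_ext; rewrite /= compc1. Qed.
Fact under_compA (X : C) (a b c d : under_obj X) (h : under_hom c d)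
  (g : under_hom b c) (f : under_hom a b) :
  under_comp h (under_comp g f) = under_comp (under_comp h g) f.
Proof. by apply: under_hom_ext; rewrite /= compcA. Qed.

Definition under_cat (X : C) : category := @Category (under_obj X) (@under_hom X)
  (@under_id X) (@under_comp X) (@under_comp1c X) (@under_compc1 X) (@under_compA X).

(* The functor [X \ C -> X' \ C] acting on arrows by [phi]. *)
Section Transport.
Variables (X X' : C) (phi : forall Y, mor X Y -> mor X' Y).
Hypothesis phiN : forall Y Z (g : mor Y Z) (f : mor X Y), phi (g \oc f) = g \oc phi f.
Definition under_tr_obj (a : under_cat X) : under_cat X' := UnderObj (phi (und_arr a)).
Fact under_tr_subproof (a b : under_cat X) (g : mor a b) :
  sval g \oc und_arr (under_tr_obj a) = und_arr (under_tr_obj b).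
Proof. by rewrite /= -phiN (svalP g). Qed.
Definition under_tr_hom (a b : under_cat X) (g : mor a b) :
  @mor (under_cat X') (under_tr_obj a) (under_tr_obj b) := exist _ (sval g) (under_tr_subproof g).
Fact under_tr_id (a : under_cat X) : under_tr_hom (idc a) = idc (under_tr_obj a).
Proof. exact: under_hom_ext. Qed.
Fact under_tr_comp (a b c : under_cat X) (g : mor b c) (f : mor a b) :
  under_tr_hom (g \oc f) = under_tr_hom g \oc under_tr_hom f.
Proof. exact: under_hom_ext. Qed.
Definition under_tr : functor (under_cat X) (under_cat X') := Functor under_tr_id under_tr_comp.
End Transport.

Lemma nerve_tr_eq (X X' : C) (phi psi : forall Y, mor X Y -> mor X' Y)
    (phiN : forall Y Z (g : mor Y Z) (f : mor X Y), phi Z (g \oc f) = g \oc phi Y f)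
    (psiN : forall Y Z (g : mor Y Z) (f : mor X Y), psi Z (g \oc f) = g \oc psi Y f)
    n (s : nerve (under_cat X) n) :
  (forall Y f, phi Y f = psi Y f) -> nerve_map (under_tr phiN) s = nerve_map (under_tr psiN) s.
Proof.
move=> e; have {}e : phi = psi.
  by apply: functional_extensionality_dep => Y; apply: functional_extensionality_dep.
by subst psi; rewrite (Prop_irrelevance phiN psiN).
Qed.

Lemma nerve_tr_id (X : C)
    (idN : forall Y Z (g : mor Y Z) (f : mor X Y), g \oc f = g \oc f)
    n (s : nerve (under_cat X) n) :
  nerve_map (@under_tr X X (fun _ f => f) idN) s = s.
Proof.
case: s => a c /=.
have E m (b : under_cat X) (d : chain m b) :
    chain_map (@under_tr X X (fun _ f => f) idN) d = d.
  elim: m b d => [|m IH] b; first by case.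
  case=> b' [g d] /=; congr existT; congr pair; last exact: IH.
  exact: under_hom_ext.
by rewrite (E _ _ c).
Qed.

Lemma nerve_tr_comp (X X' X'' : C) (phi : forall Y, mor X Y -> mor X' Y)
    (psi : forall Y, mor X' Y -> mor X'' Y)
    (phiN : forall Y Z (g : mor Y Z) (f : mor X Y), phi Z (g \oc f) = g \oc phi Y f)
    (psiN : forall Y Z (g : mor Y Z) (f : mor X' Y), psi Z (g \oc f) = g \oc psi Y f)
    (chiN : forall Y Z (g : mor Y Z) (f : mor X Y),
       psi Z (phi Z (g \oc f)) = g \oc psi Y (phi Y f))
    n (s : nerve (under_cat X) n) :
  nerve_map (@under_tr X X'' (fun Y f => psi Y (phi Y f)) chiN) s =
  nerve_map (under_tr psiN) (nerve_map (under_tr phiN) s).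
Proof.
case: s => a c /=.
have E m (b : under_cat X) (d : chain m b) :
    chain_map (@under_tr X X'' (fun Y f => psi Y (phi Y f)) chiN) d =
    chain_map (under_tr psiN) (chain_map (under_tr phiN) d).
  elim: m b d => [|m IH] b; first by case.
  case=> b' [g d] /=; congr existT; congr pair; last exact: IH.
  exact: under_hom_ext.
by rewrite (E _ _ c).
Qed.

(* Precomposition with [h : X' -> X]. *)
Definition under_map (X' X : C) (h : mor X' X) : functor (under_cat X) (under_cat X') :=
  @under_tr X X' (fun Y f => f \oc h) (fun Y Z g f => esym (compcA g f h)).

Lemma nerve_under_id (X : C) n (s : nerve (under_cat X) n) :
  nerve_map (under_map (idc X)) s = s.
Proof.
rewrite -[RHS](nerve_tr_id (fun _ _ _ _ => erefl)).
by apply: nerve_tr_eq => Y f; exact: compc1.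
Qed.
Lemma nerve_under_comp (X'' X' X : C) (h : mor X' X) (h' : mor X'' X') n
    (s : nerve (under_cat X) n) :
  nerve_map (under_map (h \oc h')) s = nerve_map (under_map h') (nerve_map (under_map h) s).
Proof.
have chiN Y Z (g : mor Y Z) (f : mor X Y) : g \oc f \oc h \oc h' = g \oc (f \oc h \oc h').
  by rewrite !compcA.
rewrite -(nerve_tr_comp _ _ chiN).
by apply: nerve_tr_eq => Y f; exact: compcA.
Qed.
End Under.

(* Simplicial [k]-modules, of which only the face maps are recorded, as degeneracies
   do not enter the associated chain complex. [ps_face n i] is [d_i], and is only
   meaningful for [i <= n.+1]. *)
Record presimplicial (k : pzRingType) := PreSimplicial {
  ps_obj :> nat -> lmodType k;
  ps_face : forall n (i : nat), {linear ps_obj n.+1 -> ps_obj n};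
  ps_face_face : forall n i j x, (i < j)%N -> (j <= n.+2)%N ->
    ps_face n i (ps_face n.+1 j x) = ps_face n j.-1 (ps_face n.+1 i x) }.
Arguments ps_face {k} X n i : rename.

Section AlternatingSum.
Context {k : pzRingType} (X : presimplicial k).
Definition alt_d n (x : X n.+1) : X n :=
  \sum_(i < n.+2) (-1) ^+ i *: ps_face X n i x.
Fact alt_d_linear n : linear (@alt_d n).
Proof.
move=> a x y; rewrite /alt_d scaler_sumr -big_split; apply: eq_bigr => i _ /=.
by rewrite linearP scalerDr !scalerA commr_sign.
Qed.
HB.instance Definition _ n :=
  GRing.isLinear.Build k (X n.+1) (X n) _ (@alt_d n) (@alt_d_linear n).
Fact alt_dd n (x : X n.+2) : alt_d (alt_d x) = 0.
Proof.
rewrite /alt_d.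
under eq_bigr => i _ do rewrite linear_sum scaler_sumr.
pose t (i j : nat) := (-1) ^+ i *: ((-1) ^+ j *: ps_face X n i (ps_face X n.+1 j x)).
have tE i j : (i < j)%N -> (j <= n.+2)%N -> t i j = - t j.-1 i.
  move=> ij jn; rewrite /t ps_face_face // !scalerA -!exprD.
  by case: j ij jn => // j ij jn; rewrite /= addnS exprS mulN1r scaleNr addnC.
transitivity (\sum_(i < n.+2) \sum_(j < n.+3) t i j).
  by apply: eq_bigr => i _; apply: eq_bigr => j _; rewrite linearZ.
pose A := \sum_(i < n.+2) \sum_(j < n.+2 | (j <= i)%N) t i j.
pose B := \sum_(i < n.+2) \sum_(j < n.+3 | (i < j)%N) t i j.
have -> : \sum_(i < n.+2) \sum_(j < n.+3) t i j = A + B.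
  rewrite -big_split; apply: eq_bigr => i _ /=.
  rewrite (bigID (fun j : 'I_n.+3 => (j <= i)%N)) /=; congr (_ + _); last first.
    by apply: eq_bigl => j; rewrite -ltnNge.
  rewrite big_mkcond big_ord_recr /= leqNgt (ltn_ord i) addr0.
  by rewrite [RHS]big_mkcond.
suff -> : B = - A by rewrite subrr.
rewrite /A (exchange_big_dep xpredT) //= -sumrN; apply: eq_bigr => i _.
rewrite big_mkcond big_ord_recl /= add0r -sumrN [RHS]big_mkcond.
apply: eq_bigr => j _ /=.
by rewrite /bump /= add1n ltnS; case: ifP => // ij; rewrite tE.
Qed.
Definition alt_complex : kcomplex k :=
  @KComplex k X (fun n => @alt_d n) alt_dd.
End AlternatingSum.

Section LinearizedNerve.
Context (k : pzRingType) {C : category}.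

Let act n (X' X : C) (h : mor X' X) :
    {linear freemod k (nerve (under_cat X) n) -> freemod k (nerve (under_cat X') n)} :=
  free_map (@nerve_map _ _ (under_map h) n).
Fact nerve_mod_id n (X : C) x : @act n X X (idc X) x = x.
Proof.
apply: (@free_hom_ext k _ _ (act n (idc X)) idfun) => s.
by rewrite /act free_recE nerve_under_id.
Qed.
Fact nerve_mod_comp n (X'' X' X : C) (h' : mor X'' X') (h : mor X' X) x :
  act n (h \oc h') x = act n h' (act n h x).
Proof.
apply: (@free_hom_ext k _ _ (act n (h \oc h')) (act n h' \o act n h)) => s.
by rewrite /act /= !free_recE nerve_under_comp.
Qed.

(* [k[N_n(- \ C)]] *)
Definition nerve_mod (n : nat) : kfunctor k (opposite C) :=
  @KFunctor k (opposite C) (fun X => freemod k (nerve (@under_cat C X) n))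
    (fun X X' h => @act n X' X h) (@nerve_mod_id n)
    (fun X X' X'' h' h => @nerve_mod_comp n X'' X' X h' h).

Fact nerve_mod_face_nat n i (X X' : opposite C) (h : mor X X') (x : nerve_mod n.+1 X) :
  free_map (@nerve_face (@under_cat C X') n i) (kmap (nerve_mod n.+1) h x) =
  kmap (nerve_mod n) h (free_map (@nerve_face (@under_cat C X) n i) x).
Proof.
apply: (@free_hom_ext k _ _
  (free_map (@nerve_face (@under_cat C X') n i) \o kmap (nerve_mod n.+1) h)
  (kmap (nerve_mod n) h \o free_map (@nerve_face (@under_cat C X) n i))) => s.
by rewrite /= /act !free_recE nerve_map_face.
Qed.
Definition nerve_mod_face n i : ktrans (nerve_mod n.+1) (nerve_mod n) :=
  @KTrans k (opposite C) (nerve_mod n.+1) (nerve_mod n)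
    (fun X => free_map (@nerve_face (@under_cat C X) n i)) (@nerve_mod_face_nat n i).

Lemma nerve_mod_face_face n i j (X : opposite C) (x : nerve_mod n.+2 X) :
  (i < j)%N -> (j <= n.+2)%N ->
  nerve_mod_face n i X (nerve_mod_face n.+1 j X x) =
  nerve_mod_face n j.-1 X (nerve_mod_face n.+1 i X x).
Proof.
move=> ij jn; apply: (@free_hom_ext k _ _
  (nerve_mod_face n i X \o nerve_mod_face n.+1 j X)
  (nerve_mod_face n j.-1 X \o nerve_mod_face n.+1 i X)) => s.
by rewrite /= !free_recE nerve_face_face.
Qed.
End LinearizedNerve.

Section NerveTensor.
Context {k : comPzRingType} {C : category} (N : kfunctor k C).

Fact nerve_tensor_face_face n i j (x : tensC (nerve_mod k n.+2) N) :
  (i < j)%N -> (j <= n.+2)%N ->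
  tensC_map N (nerve_mod_face k n i) (tensC_map N (nerve_mod_face k n.+1 j) x) =
  tensC_map N (nerve_mod_face k n j.-1) (tensC_map N (nerve_mod_face k n.+1 i) x).
Proof.
move=> ij jn; apply: (@tensC_hom_ext k C _ _ _
  (tensC_map N (nerve_mod_face k n i) \o tensC_map N (nerve_mod_face k n.+1 j))
  (tensC_map N (nerve_mod_face k n j.-1) \o tensC_map N (nerve_mod_face k n.+1 i))) => X y z.
change (tensC_map N (nerve_mod_face k n i)
    (tensC_map N (nerve_mod_face k n.+1 j) (pureC y z)) =
  tensC_map N (nerve_mod_face k n j.-1)
    (tensC_map N (nerve_mod_face k n.+1 i) (pureC y z))).
by rewrite !tensC_mapE nerve_mod_face_face.
Qed.

(* [k[N(- \ C)] (x)_C N] *)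
Definition nerve_tensor : presimplicial k :=
  @PreSimplicial k (fun n => tensC (nerve_mod k n) N)
    (fun n i => tensC_map N (nerve_mod_face k n i)) nerve_tensor_face_face.
End NerveTensor.

(* A map [{0..n-1} -> {0..m-1}] together with a strict total order on each fiber,
   the orders being bundled into one relation that only relates elements of the
   same fiber. *)
Record smor (n m : nat) := SMor {
  smap :> 'I_n -> 'I_m;
  slt : rel 'I_n;
  slt_fib : forall i j, slt i j -> smap i = smap j;
  slt_irr : irreflexive slt;
  slt_trans : transitive slt;
  slt_total : forall i j, smap i = smap j -> i != j -> slt i j || slt j i }.

Lemma smor_ext n m (f g : smor n m) : smap f =1 smap g -> slt f =2 slt g -> f = g.
Proof.
case: f g => f r rf ri rt rT [g s sf si st sT] /= fg rs.
have {}fg : f = g by exact: functional_extensionality_dep.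
have {}rs : r = s by apply: functional_extensionality_dep => i; apply: functional_extensionality_dep.
subst g s; f_equal; exact: Prop_irrelevance.
Qed.

Fact smor_id_fib n (i j : 'I_n) : false -> i = j.
Proof. by []. Qed.
Fact smor_id_total n (i j : 'I_n) : i = j -> i != j -> false || false.
Proof. by move=> -> /eqP. Qed.
Definition smor_id n : smor n n :=
  @SMor n n id (fun _ _ => false) (@smor_id_fib n)
    (fun _ => erefl) (fun _ _ _ h _ => h) (@smor_id_total n).

Section Composition.
Context {n m p : nat} (g : smor m p) (f : smor n m).
Definition comp_lt : rel 'I_n :=
  fun i j => slt g (f i) (f j) || (f i == f j) && slt f i j.
Fact comp_lt_fib i j : comp_lt i j -> g (f i) = g (f j).
Proof. by case/orP=> [/slt_fib //|/andP[/eqP -> _]]. Qed.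
Fact comp_lt_irr : irreflexive comp_lt.
Proof. by move=> i; rewrite /comp_lt !slt_irr andbF. Qed.
Fact comp_lt_trans : transitive comp_lt.
Proof.
move=> j i l; rewrite /comp_lt.
case/orP=> [gij|/andP[/eqP fij ij]]; case/orP=> [gjl|/andP[/eqP fjl jl]].
- by rewrite (slt_trans gij gjl).
- by rewrite -fjl gij.
- by rewrite fij gjl.
- by rewrite fij fjl eqxx (slt_trans ij jl) orbT.
Qed.
Fact comp_lt_total i j : g (f i) = g (f j) -> i != j -> comp_lt i j || comp_lt j i.
Proof.
move=> gij ij; rewrite /= /comp_lt; case: (eqVneq (f i) (f j)) => [fij|fij].
  by have /orP[->|->] := slt_total fij ij; rewrite !orbT.
by have /orP[->|->] := slt_total gij fij; rewrite ?orbT.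
Qed.
Definition smor_comp : smor n p :=
  @SMor n p (fun i => g (f i)) comp_lt comp_lt_fib comp_lt_irr comp_lt_trans comp_lt_total.
End Composition.

Fact smor_comp1 n m (f : smor n m) : smor_comp (smor_id m) f = f.
Proof.
apply: smor_ext => // i j; rewrite /= /comp_lt; apply/idP/idP => [/andP[]//|fij].
by rewrite (slt_fib fij) eqxx.
Qed.
Fact smor_1comp n m (f : smor n m) : smor_comp f (smor_id n) = f.
Proof. by apply: smor_ext => // i j; rewrite /= /comp_lt andbF orbF. Qed.
Fact smor_compA n m p q (h : smor p q) (g : smor m p) (f : smor n m) :
  smor_comp h (smor_comp g f) = smor_comp (smor_comp h g) f.
Proof.
apply: smor_ext => // i j; rewrite /= /comp_lt -!orbA; congr (_ || _).
rewrite /= /comp_lt; case: (eqVneq (f i) (f j)) => [->|fij] /=; last by rewrite !orbF.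
by rewrite !eqxx /= !slt_irr.
Qed.

(* The object [n] is [[n] = {0, ..., n}], with [n.+1] elements. *)
Definition DeltaS : category :=
  @Category nat (fun n m => smor n.+1 m.+1) (fun n => smor_id n.+1)
    (fun n m p => @smor_comp n.+1 m.+1 p.+1) (fun n m => @smor_comp1 _ _)
    (fun n m => @smor_1comp _ _) (fun n m p q => @smor_compA _ _ _ _).

(* The object [n] is [[n-1] = {0, ..., n-1}], with [n] elements: [0] stands for the
   additional object [[-1]], out of which there is exactly one morphism to any
   object, and into which there is none from [n.+1]. *)
Definition DeltaSplus : category :=
  @Category nat smor smor_id (@smor_comp) (@smor_comp1) (@smor_1comp) (@smor_compA).

Definition sepi n m (f : smor n m) := forall j, exists i, f i = j.

Definition epi_mor n m := {f : smor n m | sepi f}.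
Lemma epi_mor_ext n m (f g : epi_mor n m) : sval f = sval g -> f = g.
Proof. by case: f g => f pf [g pg] /= fg; subst g; rewrite (Prop_irrelevance pf pg). Qed.
Fact sepi_id n : sepi (smor_id n). Proof. by move=> j; exists j. Qed.
Fact sepi_comp n m p (g : epi_mor m p) (f : epi_mor n m) : sepi (smor_comp (sval g) (sval f)).
Proof.
by move=> j; have [i <-] := svalP g j; have [l <-] := svalP f i; exists l.
Qed.
Definition epi_id n : epi_mor n n := exist _ (smor_id n) (@sepi_id n).
Definition epi_comp n m p (g : epi_mor m p) (f : epi_mor n m) : epi_mor n p :=
  exist _ (smor_comp (sval g) (sval f)) (sepi_comp g f).
Fact epi_comp1 n m (f : epi_mor n m) : epi_comp (epi_id m) f = f.
Proof. by apply: epi_mor_ext; exact: smor_comp1. Qed.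
Fact epi_1comp n m (f : epi_mor n m) : epi_comp f (epi_id n) = f.
Proof. by apply: epi_mor_ext; exact: smor_1comp. Qed.
Fact epi_compA n m p q (h : epi_mor p q) (g : epi_mor m p) (f : epi_mor n m) :
  epi_comp h (epi_comp g f) = epi_comp (epi_comp h g) f.
Proof. by apply: epi_mor_ext; exact: smor_compA. Qed.

(* The wide subcategory of epimorphisms of [DeltaSplus]. *)
Definition EpiDeltaSplus : category :=
  @Category nat epi_mor epi_id (@epi_comp) (@epi_comp1) (@epi_1comp) (@epi_compA).

Section Fiber.
Context {n m : nat} (f : smor n m).
Definition sle : rel 'I_n := fun i j => (i == j) || slt f i j.
(* The fiber over [j], listed in increasing order. *)
Definition fiber (j : 'I_m) : seq 'I_n := sort sle [seq i <- enum 'I_n | f i == j].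

Lemma mem_fiber i j : (i \in fiber j) = (f i == j).
Proof. by rewrite mem_sort mem_filter mem_enum andbT. Qed.
Lemma fiber_uniq j : uniq (fiber j).
Proof. by rewrite sort_uniq filter_uniq // enum_uniq. Qed.
Lemma sle_trans : transitive sle.
Proof.
move=> j i l /orP[/eqP -> //|ij] /orP[/eqP <-|jl]; rewrite /sle ?ij ?orbT //.
by rewrite (slt_trans ij jl) orbT.
Qed.
Lemma fiber_sorted j : sorted (slt f) (fiber j).
Proof.
have tot : {in [pred i | f i == j] &, total sle}.
  move=> i l; rewrite !inE => /eqP fi /eqP fl; rewrite /sle.
  case: eqVneq => //= il.
  by apply: slt_total => //; rewrite fi fl.
have s : sorted sle (fiber j).
  by apply: sort_sorted_in tot _ _; apply/allP => i; rewrite mem_filter => /andP[].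
have := fiber_uniq j; elim: (fiber j) s => // i [|l r] // IH.
move=> /= /andP[il s] /andP[iN u]; apply/andP; split; last exact: IH.
move: il; rewrite /sle => /orP[/eqP il|//].
by move: iN; rewrite il inE eqxx.
Qed.
Lemma fiber_unique j (s : seq 'I_n) :
  sorted (slt f) s -> (forall i, (i \in s) = (f i == j)) -> s = fiber j.
Proof.
move=> ss ms; apply: (@irr_sorted_eq _ (slt f)) => //.
- exact: slt_trans.
- exact: slt_irr.
- exact: fiber_sorted.
- by move=> i; rewrite ms mem_fiber.
Qed.
End Fiber.

Lemma fiber_id n (j : 'I_n) : fiber (smor_id n) j = [:: j].
Proof. by symmetry; apply: fiber_unique => // i; rewrite inE. Qed.

Lemma fiber_comp n m p (g : smor m p) (f : smor n m) j :
  fiber (smor_comp g f) j = flatten [seq fiber f l | l <- fiber g j].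
Proof.
symmetry; apply: fiber_unique => [|i]; last first.
  apply/flatten_mapP/eqP => [[l] |<-].
    by rewrite !mem_fiber => /eqP gl /eqP fi; rewrite /= fi.
  by exists (f i); rewrite mem_fiber.
rewrite (sorted_pairwise (@slt_trans _ _ _)).
have := fiber_sorted g j; rewrite (sorted_pairwise (@slt_trans _ _ g)).
elim: (fiber g j) => //= l s IH /andP[ls ss].
rewrite pairwise_cat IH // andbT; apply/andP; split.
  apply/allrelP => i i' fi /flatten_mapP[l' l's].
  move: fi; rewrite !mem_fiber /comp_lt => /eqP -> /eqP ->.
  by move/allP: ls => ->.
have := fiber_sorted f l; rewrite (sorted_pairwise (@slt_trans _ _ f)).
apply: sub_in_pairwise (allss _) => i i'; rewrite !mem_fiber /comp_lt => /eqP -> /eqP ->.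
by rewrite eqxx => ->; rewrite orbT.
Qed.

Section FiberProduct.
Context {k : comPzRingType} {A : algType k}.

Definition fprod {n m} (f : smor n m) (a : 'I_n -> A) (j : 'I_m) : A :=
  \prod_(i <- fiber f j) a i.

Lemma fprod_id n (a : 'I_n -> A) : fprod (smor_id n) a = a.
Proof.
by apply: functional_extensionality_dep => j; rewrite /fprod fiber_id big_seq1.
Qed.
Lemma fprod_comp n m p (g : smor m p) (f : smor n m) (a : 'I_n -> A) :
  fprod (smor_comp g f) a = fprod g (fprod f a).
Proof.
apply: functional_extensionality_dep => j.
by rewrite /fprod fiber_comp big_flatten big_map.
Qed.

Lemma prod_update n (i : 'I_n) c (x y z : 'I_n -> A) (s : seq 'I_n) :
  (forall j, j != i -> x j = y j /\ x j = z j) -> x i = c *: y i + z i ->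
  uniq s -> i \in s ->
  \prod_(j <- s) x j = c *: (\prod_(j <- s) y j) + \prod_(j <- s) z j.
Proof.
move=> xyz xi; elim: s => // l s IH /= /andP[ls us]; rewrite inE !big_cons.
case: (eqVneq i l) => [il _|il /= si].
  have same (u : 'I_n -> A) : (forall j, j != i -> x j = u j) ->
      \prod_(j <- s) x j = \prod_(j <- s) u j.
    move=> xu; apply: eq_big_seq => j js; apply: xu; apply: contraNneq ls => ji.
    by rewrite -il -ji.
  rewrite -(same y) -?(same z); try by move=> j /xyz[].
  by rewrite -il xi mulrDl scalerAl.
have li : l != i by rewrite eq_sym.
have [<- xz] := xyz l li.
by rewrite -xz IH // mulrDr scalerAr.
Qed.

Lemma prod_update_notin n (i : 'I_n) (x y : 'I_n -> A) (s : seq 'I_n) :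
  (forall j, j != i -> x j = y j) -> i \notin s ->
  \prod_(j <- s) x j = \prod_(j <- s) y j.
Proof.
by move=> xy si; apply: eq_big_seq => j js; apply: xy; apply: contraNneq si => <-.
Qed.
End FiberProduct.

Section BarA.
Context {k : comPzRingType} (A : algType k).
Fact bar_multilinear n m (f : smor n m) :
  multilinear (fun a : 'I_n -> A => tpure (fprod f a)).
Proof.
move=> i c x y z xyz xi; apply: (tpure_multilinear (i := f i)) => [j jfi|].
  have H : i \notin fiber f j by rewrite mem_fiber eq_sym.
  by split; apply: prod_update_notin H => l /xyz[].
by apply: (prod_update xyz xi); rewrite ?fiber_uniq // mem_fiber.
Qed.
Definition bar_map n m (f : smor n m) : {linear tpow A n -> tpow A m} :=
  tpow_rec (bar_multilinear f).
Lemma bar_mapE n m (f : smor n m) a : bar_map f (tpure a) = tpure (fprod f a).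
Proof. exact: tpow_recE. Qed.
Fact bar_map_id n x : bar_map (smor_id n) x = x.
Proof.
apply: (@tpow_hom_ext k _ _ _ (bar_map (smor_id n)) idfun) => a.
by rewrite bar_mapE fprod_id.
Qed.
Fact bar_map_comp n m p (g : smor m p) (f : smor n m) x :
  bar_map (smor_comp g f) x = bar_map g (bar_map f x).
Proof.
apply: (@tpow_hom_ext k _ _ _ (bar_map (smor_comp g f)) (bar_map g \o bar_map f)) => a.
by rewrite -[RHS]/(bar_map g (bar_map f (tpure a))) !bar_mapE fprod_comp.
Qed.

(* [[n] |-> A^(n+1)], the [n+1]-st tensor power. *)
Definition Bsym : kfunctor k DeltaS :=
  @KFunctor k DeltaS (fun n => tpow A n.+1) (fun n m f => bar_map f)
    (fun n => @bar_map_id n.+1) (fun n m p g f => bar_map_comp g f).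

Definition HS (n : nat) : lmodType k := Tor (kconst (opposite DeltaS) k^o) Bsym n.
End BarA.

Section BarI.
Context {k : comPzRingType} {A : algType k}.
(* An augmentation, i.e. a morphism of unital [k]-algebras to [k]. *)
Variable eps : {lrmorphism A -> k | *%R}.

Definition aug_ideal : lmodType k := kermod eps.

Fact fprodI_subproof n m (f : epi_mor n m) (a : 'I_n -> aug_ideal) j :
  kerP eps (fprod (sval f) (fun i => val (a i)) j).
Proof.
have [i fi] := svalP f j; rewrite /kerP inE /fprod.
have : i \in fiber (sval f) j by rewrite mem_fiber fi.
case: (fiber (sval f) j) => // l s _.
have e : eps (val (a l)) = 0 := kermodP (a l).
by rewrite big_cons rmorphM /= e mul0r.
Qed.
Definition fprodI n m (f : epi_mor n m) (a : 'I_n -> aug_ideal) (j : 'I_m) : aug_ideal :=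
  exist _ (fprod (sval f) (fun i => val (a i)) j) (fprodI_subproof f a j).

Fact barI_multilinear n m (f : epi_mor n m) :
  multilinear (fun a : 'I_n -> aug_ideal => tpure (fprodI f a)).
Proof.
move=> i c x y z xyz xi; apply: (tpure_multilinear (i := sval f i)) => [j jfi|].
  have H : i \notin fiber (sval f) j by rewrite mem_fiber eq_sym.
  by split; apply: val_inj; apply: prod_update_notin H => l /xyz[xy xz]; congr val.
apply: val_inj; apply: (@prod_update k A n i c); rewrite ?fiber_uniq ?mem_fiber //.
  by move=> j /xyz[xy xz]; split; congr val.
by rewrite xi.
Qed.
Definition barI_map n m (f : epi_mor n m) : {linear tpow aug_ideal n -> tpow aug_ideal m} :=
  tpow_rec (barI_multilinear f).
Lemma barI_mapE n m (f : epi_mor n m) a : barI_map f (tpure a) = tpure (fprodI f a).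
Proof. exact: tpow_recE. Qed.
Fact barI_map_id n x : barI_map (epi_id n) x = x.
Proof.
apply: (@tpow_hom_ext k _ _ _ (barI_map (epi_id n)) idfun) => a.
rewrite barI_mapE; congr tpure; apply: functional_extensionality_dep => j.
by apply: val_inj; rewrite /= fprod_id.
Qed.
Fact barI_map_comp n m p (g : epi_mor m p) (f : epi_mor n m) x :
  barI_map (epi_comp g f) x = barI_map g (barI_map f x).
Proof.
apply: (@tpow_hom_ext k _ _ _ (barI_map (epi_comp g f)) (barI_map g \o barI_map f)) => a.
rewrite -[RHS]/(barI_map g (barI_map f (tpure a))) !barI_mapE.
congr tpure; apply: functional_extensionality_dep => j.
by apply: val_inj; rewrite /= fprod_comp.
Qed.

Definition BsymI : kfunctor k EpiDeltaSplus :=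
  @KFunctor k EpiDeltaSplus (fun n => tpow aug_ideal n) (fun n m f => barI_map f)
    barI_map_id (fun n m p g f => barI_map_comp g f).

Definition Yepi : presimplicial k := nerve_tensor BsymI.
End BarI.

Definition lmod_iso {k : pzRingType} (V W : lmodType k) :=
  exists f : {linear V -> W}, bijective f.

Lemma tpow0_iso (k : comPzRingType) (V : lmodType k) : lmod_iso (tpow V 0) k^o.
Proof.
have fM : multilinear (fun _ : 'I_0 -> V => 1 : k^o) by case.
pose g : {linear k^o -> tpow V 0} := scale_at (tpure (fun _ => 0)).
exists (tpow_rec fM), g => [x|a].
  apply: (@tpow_hom_ext k V 0 _ (g \o tpow_rec fM) idfun) => v.
  rewrite -[LHS]/(g (tpow_rec fM (tpure v))) tpow_recE /g /= /scale_at scale1r.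
  by congr tpure; apply: functional_extensionality_dep; case.
have -> : g a = (a : k) *: tpure (fun _ : 'I_0 => 0 : V) by [].
by rewrite linearZ_LR tpow_recE /GRing.scale /= mulr1.
Qed.

(* Main.v *)
Require Import Defs.
From HB Require Import structures.
From mathcomp Require Import all_boot all_order all_algebra.
From mathcomp Require Import boolp.

(** Write [E] for the category of epimorphisms, [I] for the augmentation ideal and [P] for
    a projective resolution of the constant functor [k] over [DeltaS].

    Since [A = k + I] as a module, the [n]-th tensor power of [A] is the sum, over the
    subsets [S] of an [n]-element set, of the tensor powers of [I] indexed by [S].
    Every morphism factors uniquely as an epimorphism followed by a monotone injection,
    and such injections are the subsets of their codomain; hence the tensor powers of
    [A] are the left Kan extension of those of [I] along the inclusion of [E] in the
    category of all morphisms, and each [k[mor(-, n)]], restricted to [E], is a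
    direct sum of representable functors ([lan_recE], [barIA_hom_ext]).

    Consequently [P (x) A^*] is isomorphic to [(extf P) (x) I^*], where [extf P] extends
    [P] to the empty set by a tensor product with the morphisms out of a given object
    ([to_bar], [from_bar]). It remains to see that [extf P] is a projective
    resolution of [k] over [E]. Projectivity is the unique factorization again
    ([extf_cover_projective]). At nonempty objects [extf P] is [P] by the co-Yoneda
    lemma; at the empty set it computes the homology of [DeltaS], which is
    that of a point because of the natural maps [X -> [0] + X <- [0]]
    ([ext_exact_empty]).

    Finally [k[N(- \ E)]] is also a projective resolution of [k]
    ([nerve_resolution]): a chain under [X] is a chain of [E] with an arrow from [X]
    to its first vertex, which makes these modules free, and the identity of [X] is
    initial under [X], which makes the complex contractible. Two projective resolutions
    give the same homology ([Tor_resolution]). *)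

Set Implicit Arguments.
Unset Strict Implicit.
Unset Printing Implicit Defensive.
Import GRing.Theory.
Local Open Scope ring_scope.

(* These constructions are used through their characteristic equations; unfolding them
   makes simplification and unification intractable. *)
#[local] Opaque tensC_map tensC_rec tpow_rec bar_map barI_map free_rec free_map.
#[local] Opaque free_gen pureC tpure.
(* Finite functions and finite sets have their own [fprod] and [cover]. *)
Local Notation fprod := Defs.fprod.
Local Notation cover := Defs.cover.

(** * Homology of complexes, and lifting along projectives *)

Section HomologyMap.
Context {k : pzRingType} {C D : kcomplex k}.
Variable f : forall n, {linear C n -> D n}.
Hypothesis fd : forall n x, f n (cx_d C n x) = cx_d D n (f n.+1 x).

Fact cycle_map_subproof n (z : kermod (cx_out C n)) : kerP (cx_out D n) (f n (val z)).
Proof.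
apply/eqP; case: n z => [//|n] z /=; rewrite -fd.
by rewrite (kermodP (z : kermod (cx_d C n))) linear0.
Qed.
Definition cycle_map n (z : kermod (cx_out C n)) : kermod (cx_out D n) :=
  exist _ (f n (val z)) (cycle_map_subproof z).
Fact cycle_map_linear n : linear (@cycle_map n).
Proof. by move=> a x y; apply: val_inj; rewrite /= !linearP. Qed.
HB.instance Definition _ n :=
  GRing.isLinear.Build k _ _ _ (@cycle_map n) (@cycle_map_linear n).

Fact homology_map_subproof n z : @cx_boundary k C n z ->
  (quot_pi (@cx_boundary k D n) \o @cycle_map n) z = 0.
Proof.
move=> [y zy] /=; rewrite -[RHS](linear0 (quot_pi _)); apply/quot_piP.
by rewrite subr0; apply: span_in; exists (f n.+1 y); rewrite /= zy fd.
Qed.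
Definition homology_map n : {linear homology C n -> homology D n} :=
  quot_rec (@homology_map_subproof n).
Lemma homology_mapE n z :
  homology_map n (quot_pi _ z) = quot_pi _ (cycle_map z).
Proof. exact: quot_recE. Qed.
End HomologyMap.

(** Only cycles matter in homology, so it is enough that [g \o f] and [f \o g] move
    each cycle by a boundary; this covers isomorphisms of complexes as well as chain
    homotopy equivalences. *)
Lemma homology_iso (k : pzRingType) (C D : kcomplex k)
    (f : forall n, {linear C n -> D n}) (g : forall n, {linear D n -> C n}) :
  (forall n x, f n (cx_d C n x) = cx_d D n (f n.+1 x)) ->
  (forall n x, g n (cx_d D n x) = cx_d C n (g n.+1 x)) ->
  (forall n x, cx_out C n x = 0 -> exists y, g n (f n x) - x = cx_d C n y) ->
  (forall n x, cx_out D n x = 0 -> exists y, f n (g n x) - x = cx_d D n y) ->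
  forall n, lmod_iso (homology C n) (homology D n).
Proof.
move=> fd gd gf fg n; exists (homology_map fd n), (homology_map gd n).
  elim/(@quot_ind _ _ (@cx_boundary k C n))=> z.
  rewrite !homology_mapE; apply/quot_piP/span_in.
  by apply: gf; exact: kermodP.
elim/(@quot_ind _ _ (@cx_boundary k D n))=> z.
rewrite !homology_mapE; apply/quot_piP/span_in.
by apply: fg; exact: kermodP.
Qed.

Lemma complex_iso_homology (k : pzRingType) (C D : kcomplex k)
    (f : forall n, {linear C n -> D n}) (g : forall n, {linear D n -> C n}) :
  (forall n x, f n (cx_d C n x) = cx_d D n (f n.+1 x)) ->
  (forall n x, g n (cx_d D n x) = cx_d C n (g n.+1 x)) ->
  (forall n, cancel (f n) (g n)) -> (forall n, cancel (g n) (f n)) ->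
  forall n, lmod_iso (homology C n) (homology D n).
Proof.
move=> fd gd fK gK; apply: homology_iso fd gd _ _ => n x _; exists 0;
  by rewrite linear0 ?fK ?gK subrr.
Qed.

Lemma lmod_iso_trans (k : pzRingType) (U V W : lmodType k) :
  lmod_iso U V -> lmod_iso V W -> lmod_iso U W.
Proof.
move=> [f bf] [g bg]; exists (g \o f : {linear U -> W}); exact: bij_comp.
Qed.

Lemma lmod_iso_sym (k : pzRingType) (U V : lmodType k) :
  lmod_iso U V -> lmod_iso V U.
Proof.
move=> [f [g fK gK]].
have glin : linear g by move=> a x y; apply: (can_inj fK); rewrite linearP !gK.
pose G : {linear V -> U} := HB.pack g (GRing.isLinear.Build k V U _ g glin).
by exists G, f.
Qed.

Section Comparison.
Context {k : pzRingType} {C : category}.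

Definition ktrans_sub (M N : kfunctor k C) (phi psi : ktrans M N) : ktrans M N.
Proof.
exists (fun X => phi X \- psi X).
abstract by move=> X Y f x /=; rewrite !kcomp_nat linearB.
Defined.

Definition ktrans_id (M : kfunctor k C) : ktrans M M :=
  @KTrans k C M M (fun X => idfun) (fun X Y f x => erefl).

Definition ktrans0 (M N : kfunctor k C) : ktrans M N.
Proof.
exists (fun X => \0).
abstract by move=> X Y f x /=; rewrite linear0.
Defined.

Section Corestriction.
Context {L M N : kfunctor k C} (phi : ktrans M N) (psi : ktrans L M).
Hypothesis phi_psi : forall X x, phi X (psi X x) = 0.

Fact kker_corestr_subproof X x : kerP (phi X) (psi X x).
Proof. exact/eqP/phi_psi. Qed.
Definition kker_corestr_fun X (x : L X) : kermod (phi X) :=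
  exist _ (psi X x) (kker_corestr_subproof x).
Fact kker_corestr_linear X : linear (@kker_corestr_fun X).
Proof. by move=> a x y; apply: val_inj; rewrite /= linearP. Qed.
HB.instance Definition _ X :=
  GRing.isLinear.Build k _ _ _ (@kker_corestr_fun X) (@kker_corestr_linear X).
Fact kker_corestr_nat X Y (f : mor X Y) (x : L X) :
  kker_corestr_fun (kmap L f x) = kmap (kker phi) f (kker_corestr_fun x).
Proof. by apply: val_inj; rewrite /= kcomp_nat. Qed.
Definition kker_corestr : ktrans L (kker phi) :=
  @KTrans k C L (kker phi) (fun X => @kker_corestr_fun X) kker_corestr_nat.
End Corestriction.

(** A sequence [... -> X 2 -> X 1 -> X 0] stands for an augmented complex, with
    [X 0] the object that is resolved; everything is a cycle in degree [0], so that
    exactness there is the surjectivity of the augmentation. *)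
Definition cyc (X : nat -> kfunctor k C) (d : forall n, ktrans (X n.+1) (X n))
    (n : nat) (U : C) : X n U -> Prop :=
  match n return X n U -> Prop with
  | 0 => fun _ => True
  | m.+1 => fun x => d m U x = 0
  end.

Definition exact_seq (X : nat -> kfunctor k C) (d : forall n, ktrans (X n.+1) (X n)) :=
  forall n U (x : X n U), cyc d x <-> exists y, x = d n U y.

Lemma exact_dd X d : @exact_seq X d -> forall n U x, d n U (d n.+1 U x) = 0.
Proof. by move=> ex n U x; apply/(ex n.+1); exists x. Qed.

#[local] Arguments exact_dd {X d} ex n U x.

(** Exactness says that [d n] maps onto the kernel of the next differential (onto all of
    [Y 0] when [n = 0]), so a map into that kernel lifts by projectivity. *)
Lemma projective_lift (P : kfunctor k C) (Y : nat -> kfunctor k C)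
    (d : forall n, ktrans (Y n.+1) (Y n)) n (phi : ktrans P (Y n)) :
  kprojective P -> exact_seq d -> (forall U x, cyc d (phi U x)) ->
  exists psi : ktrans P (Y n.+1), forall U x, d n U (psi U x) = phi U x.
Proof.
move=> Pproj ex; case: n phi => [|n] phi cphi.
  by apply: Pproj => U y; have /ex[x ->] : cyc d y by []; exists x.
have pepi : kepi (kker_corestr (exact_dd ex n)).
  move=> U y; have /ex[x yE] : cyc d (val y : Y n.+1 U) by exact: (kermodP y).
  by exists x; apply: val_inj; exact: esym yE.
have [psi psiE] := Pproj _ _ _ (kker_corestr cphi) pepi.
by exists psi => U x; rewrite -[RHS]/(val (kker_corestr cphi U x)) -psiE.
Qed.

Section Lift.
Variables (X Y : nat -> kfunctor k C).
Variables (dX : forall n, ktrans (X n.+1) (X n)) (dY : forall n, ktrans (Y n.+1) (Y n)).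
Hypothesis Xproj : forall n, kprojective (X n.+1).
Hypothesis Xdd : forall n U x, dX n U (dX n.+1 U x) = 0.
Hypothesis Yex : exact_seq dY.

(** The lift is built degree by degree; what is carried along is that the map just
    constructed sends boundaries to cycles, so that [projective_lift] applies. *)
Lemma chain_lift (f0 : ktrans (X 0) (Y 0)) :
  exists f : forall n, ktrans (X n) (Y n), f 0 = f0 /\
    forall n U x, dY n U (f n.+1 U x) = f n U (dX n U x).
Proof.
pose st n := {f : ktrans (X n) (Y n) | forall U x, cyc dY (f U (dX n U x))}.
have step n (s : st n) :
    {t : st n.+1 | forall U x, dY n U (sval t U x) = sval s U (dX n U x)}.
  case: s => f fP; apply: cid => /=.
  have [psi psiE] := @projective_lift _ _ _ _ (ktrans_comp f (dX n)) (@Xproj n) Yex fP.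
  have psiP U x : cyc dY (psi U (dX n.+1 U x)) by rewrite /= psiE /= Xdd linear0.
  by exists (exist _ psi psiP).
have f0P U x : cyc dY (f0 U (dX 0 U x)) by [].
pose s : forall n, st n := nat_rect st (exist _ f0 f0P) (fun n t => sval (step n t)).
exists (fun n => sval (s n)); split=> // n U x.
exact: (svalP (step n (s n))).
Qed.

(** As for [chain_lift]: [f - g - h d] takes its values in the cycles, and lifting it
    gives the next component of [h]. *)
Lemma chain_homotopy (f g : forall n, ktrans (X n) (Y n)) :
  (forall n U x, dY n U (f n.+1 U x) = f n U (dX n U x)) ->
  (forall n U x, dY n U (g n.+1 U x) = g n U (dX n U x)) ->
  (forall U x, f 0 U x = g 0 U x) ->
  exists h : forall n, ktrans (X n) (Y n.+1), (forall U x, h 0 U x = 0) /\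
    forall n U x,
      f n.+1 U x - g n.+1 U x = dY n.+1 U (h n.+1 U x) + h n U (dX n U x).
Proof.
move=> fd gd fg0.
pose st n := {h : ktrans (X n) (Y n.+1) |
  forall U x, dY n U (f n.+1 U x - g n.+1 U x - h U (dX n U x)) = 0}.
have step n (s : st n) : {t : st n.+1 | forall U x,
    f n.+1 U x - g n.+1 U x = dY n.+1 U (sval t U x) + sval s U (dX n U x)}.
  case: s => h hP; apply: cid => /=.
  pose phi := ktrans_sub (ktrans_sub (f n.+1) (g n.+1)) (ktrans_comp h (dX n)).
  have [psi psiE] := @projective_lift _ _ _ n.+1 phi (@Xproj n) Yex hP.
  have psiP U x : dY n.+1 U (f n.+2 U x - g n.+2 U x - psi U (dX n.+1 U x)) = 0.
    by rewrite !linearB psiE fd gd /= Xdd linear0 subr0 subrr.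
  by exists (exist _ psi psiP) => U x /=; rewrite psiE /= subrK.
have h0P U x : dY 0 U (f 1%N U x - g 1%N U x - ktrans0 (X 0) (Y 1%N) U (dX 0 U x)) = 0.
  by rewrite /= subr0 linearB fd gd fg0 subrr.
pose s : forall n, st n := nat_rect st (exist _ _ h0P) (fun n t => sval (step n t)).
exists (fun n => sval (s n)); split=> // n U x.
exact: (svalP (step n (s n))).
Qed.
End Lift.

Definition aug_obj (M : kfunctor k C) (P : resolution M) (n : nat) : kfunctor k C :=
  if n is m.+1 then P m else M.
Definition aug_d (M : kfunctor k C) (P : resolution M) n :
    ktrans (aug_obj P n.+1) (aug_obj P n) :=
  match n with 0 => res_aug P | m.+1 => res_d P m end.

Lemma aug_exact (M : kfunctor k C) (P : resolution M) : exact_seq (@aug_d M P).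
Proof.
move=> [|[|n]] U x; [|exact: res_exact0|exact: res_exact].
by split=> // _; have [y <-] := @res_epi _ _ _ P U x; exists y.
Qed.

Lemma aug_projective (M : kfunctor k C) (P : resolution M) n :
  kprojective (aug_obj P n.+1).
Proof. exact: res_projective. Qed.
End Comparison.
Arguments exact_dd {k C X d} ex n U x.
Arguments aug_exact {k C M} P.
Arguments aug_projective {k C M} P.

Lemma free_mapE (k : pzRingType) (S T : Type) (f : S -> T) s :
  @free_map k S T f (free_gen s) = free_gen (f s).
Proof. exact: free_recE. Qed.

(** * Derived functors computed by an arbitrary resolution *)

Section TensorMap.
Context {k : comPzRingType} {C : category} {N : kfunctor k C}.

Lemma pureCDl (M : kfunctor k (opposite C)) (X : C) (y y' : M X) (x : N X) :
  pureC (y + y') x = pureC y x + pureC y' x.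
Proof. by have := pureC_linearl x 1 y y'; rewrite !scale1r. Qed.

Lemma tensC_map_comp (M M' M'' : kfunctor k (opposite C)) (psi : ktrans M' M'')
    (phi : ktrans M M') t :
  tensC_map N (ktrans_comp psi phi) t = tensC_map N psi (tensC_map N phi t).
Proof.
apply: (@tensC_hom_ext k C M N _ (tensC_map N (ktrans_comp psi phi))
  (tensC_map N psi \o tensC_map N phi)) => X y x /=.
by rewrite !tensC_mapE.
Qed.

Lemma tensC_map_id (M : kfunctor k (opposite C)) (phi : ktrans M M) t :
  (forall X x, phi X x = x) -> tensC_map N phi t = t.
Proof.
move=> E; apply: (@tensC_hom_ext k C M N _ (tensC_map N phi) idfun) => X y x /=.
by rewrite tensC_mapE E.
Qed.

Lemma tensC_map0 (M M' : kfunctor k (opposite C)) (phi : ktrans M M') t :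
  (forall X x, phi X x = 0) -> tensC_map N phi t = 0.
Proof.
move=> E; apply: (@tensC_hom_ext k C M N _ (tensC_map N phi) \0) => X y x /=.
by rewrite tensC_mapE E pureC0l.
Qed.

(** A homotopy [phi - id = d h + h' d'] survives the tensor product, where its last term
    vanishes on cycles. *)
Lemma tensC_map_homotopy (M M' M'' : kfunctor k (opposite C)) (phi : ktrans M M)
    (d : ktrans M' M) (h : ktrans M M') (h' : ktrans M'' M) (d' : ktrans M M'') t :
  (forall X x, phi X x - x = d X (h X x) + h' X (d' X x)) ->
  tensC_map N (ktrans_comp h' d') t = 0 ->
  tensC_map N phi t - t = tensC_map N d (tensC_map N h t).
Proof.
move=> E h0; rewrite -[RHS]addr0 -h0.
apply: (@tensC_hom_ext k C M N _ (tensC_map N phi \- idfun)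
  ((tensC_map N d \o tensC_map N h) \+ tensC_map N (ktrans_comp h' d'))) => X y x /=.
rewrite !tensC_mapE -pureCDl -E /=.
by rewrite -scaleN1r -[LHS]addrC -pureC_linearl scaleN1r addrC.
Qed.
End TensorMap.

Section TorResolution.
Context {k : comPzRingType} {C : category}.
Variables (M : kfunctor k (opposite C)) (N : kfunctor k C).

Lemma comparison_map (P Q : resolution M) :
  exists f : forall n, ktrans (aug_obj P n) (aug_obj Q n), f 0 = ktrans_id M /\
    forall n U x, aug_d Q n U (f n.+1 U x) = f n U (aug_d P n U x).
Proof.
apply: chain_lift; [exact: aug_projective | exact: (exact_dd (aug_exact P)) |].
exact: aug_exact.
Qed.

(** Both [g \o f] and the identity lift the identity of [M], so they are homotopic; the
    homotopy vanishes on [M] itself, which settles degree [0]. *)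
Lemma comparison_cycle (P Q : resolution M)
    (f : forall n, ktrans (aug_obj P n) (aug_obj Q n))
    (g : forall n, ktrans (aug_obj Q n) (aug_obj P n)) :
  (forall U x, f 0 U x = x) -> (forall U x, g 0 U x = x) ->
  (forall n U x, aug_d Q n U (f n.+1 U x) = f n U (aug_d P n U x)) ->
  (forall n U x, aug_d P n U (g n.+1 U x) = g n U (aug_d Q n U x)) ->
  forall n (x : tensC (P n) N), cx_out (tor_complex N P) n x = 0 ->
  exists y, tensC_map N (g n.+1) (tensC_map N (f n.+1) x) - x = cx_d (tor_complex N P) n y.
Proof.
move=> f0 g0 fd gd n x x0.
have [h [h0 hE]] := @chain_homotopy _ _ _ _ (aug_d P) (aug_d P)
  (aug_projective P) (exact_dd (aug_exact P)) (aug_exact P)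
  (fun n => ktrans_comp (g n) (f n)) (fun n => ktrans_id (aug_obj P n))
  (fun n U x => etrans (gd n U (f n.+1 U x)) (f_equal (g n U) (fd n U x)))
  (fun n U x => erefl) (fun U x => etrans (g0 U _) (f0 U x)).
exists (tensC_map N (h n.+1) x).
rewrite -tensC_map_comp.
apply: (@tensC_map_homotopy _ _ _ _ _ _ _ _ _ (h n) (aug_d P n)) => [X y|].
  exact: hE.
case: n x x0 => [|n] x x0; first by apply: tensC_map0 => X y; exact: h0.
rewrite tensC_map_comp; rewrite -[RHS](linear0 (tensC_map N (h n.+1))).
by congr (tensC_map N (h n.+1) _).
Qed.

(** Two projective resolutions are homotopy equivalent, so either of them computes
    the derived functors. *)
Lemma Tor_resolution (P Q : resolution M) n :
  lmod_iso (homology (tor_complex N P) n) (homology (tor_complex N Q) n).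
Proof.
have [f [f0 fd]] := comparison_map P Q; have [g [g0 gd]] := comparison_map Q P.
have f0E U x : f 0 U x = x by rewrite f0.
have g0E U x : g 0 U x = x by rewrite g0.
have nat_d (P' Q' : resolution M) (e : forall n, ktrans (aug_obj P' n) (aug_obj Q' n)) :
    (forall n U x, aug_d Q' n U (e n.+1 U x) = e n U (aug_d P' n U x)) ->
    forall n x, tensC_map N (e n.+1) (cx_d (tor_complex N P') n x) =
                cx_d (tor_complex N Q') n (tensC_map N (e n.+2) x).
  move=> ed m x; rewrite /= -!tensC_map_comp.
  by apply: (@tensC_hom_ext k C _ N _ (tensC_map N _) (tensC_map N _)) => X y z;
    rewrite !tensC_mapE; congr pureC; rewrite /= -(ed m.+1).
apply: (@homology_iso _ (tor_complex N P) (tor_complex N Q)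
  (fun n => tensC_map N (f n.+1)) (fun n => tensC_map N (g n.+1))).
- exact: nat_d.
- exact: nat_d.
- exact: comparison_cycle.
- exact: comparison_cycle.
Qed.
End TorResolution.

(** * The nerves of the under-categories form a resolution *)

Section NerveResolution.
Context (k : pzRingType) {C : category}.

Definition nerve_at (X : opposite C) : presimplicial k :=
  @PreSimplicial k (fun n => nerve_mod k n X) (fun n i => nerve_mod_face k n i X)
    (fun n i j x => @nerve_mod_face_face k C n i j X x).

Fact nerve_d_nat n (X Y : opposite C) (f : mor X Y) (x : nerve_mod k n.+1 X) :
  @alt_d k (nerve_at Y) n (kmap (nerve_mod k n.+1) f x) =
  kmap (nerve_mod k n) f (@alt_d k (nerve_at X) n x).
Proof.
rewrite /alt_d linear_sum; apply: eq_bigr => i _.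
rewrite linearZ; congr (_ *: _); exact: (kcomp_nat (nerve_mod_face k n i)).
Qed.
Definition nerve_d n : ktrans (nerve_mod k n.+1) (nerve_mod k n) :=
  @KTrans k (opposite C) (nerve_mod k n.+1) (nerve_mod k n)
    (fun X => @alt_d k (nerve_at X) n : {linear nerve_at X n.+1 -> nerve_at X n})
    (@nerve_d_nat n).

Fact nerve_aug_nat (X Y : opposite C) (f : mor X Y) (x : nerve_mod k 0 X) :
  free_rec (fun _ => 1 : k^o) (kmap (nerve_mod k 0) f x) =
  kmap (kconst (opposite C) k^o) f (free_rec (fun _ => 1 : k^o) x).
Proof.
apply: (@free_hom_ext k _ _ (free_rec (fun _ => 1 : k^o) \o kmap (nerve_mod k 0) f)
  (free_rec (fun _ => 1 : k^o))) => s /=.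
by rewrite free_mapE !free_recE.
Qed.
Definition nerve_aug : ktrans (nerve_mod k 0) (kconst (opposite C) k^o) :=
  @KTrans k (opposite C) (nerve_mod k 0) (kconst (opposite C) k^o)
    (fun X => free_rec (fun _ => 1 : k^o)) nerve_aug_nat.

(** The extra degeneracy: the identity of [X] is initial in [X \ C], so it can be
    put in front of every chain. *)
Section Cone.
Variable X : C.
Let U := @under_cat C X.

Definition und_idc : U := UnderObj (idc X).

Definition nerve_cone n (s : nerve U n) : nerve U n.+1 :=
  let: existT a c := s in
  existT _ und_idc (existT _ a (exist _ (und_arr a) (compc1 (und_arr a)), c)).

Lemma nerve_cone_face0 n (s : nerve U n) : nerve_face 0 (nerve_cone s) = s.
Proof. by case: s. Qed.

Lemma nerve_cone_faceS n i (s : nerve U n.+1) :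
  nerve_face i.+1 (nerve_cone s) = nerve_cone (nerve_face i s).
Proof.
case: s => a [b [g c]]; case: i => [|i] //=.
do 2 congr existT; congr pair; apply: under_hom_ext; exact: (svalP g).
Qed.

Definition cone_map n : {linear freemod k (nerve U n) -> freemod k (nerve U n.+1)} :=
  free_map (@nerve_cone n).

Lemma nerve_d_coneS n (x : nerve_mod k n.+1 X) :
  nerve_d n.+1 X (cone_map n.+1 x) = x - cone_map n (nerve_d n X x).
Proof.
apply: (@free_hom_ext k _ _ (nerve_d n.+1 X \o cone_map n.+1)
  (idfun \- (cone_map n \o nerve_d n X))) => s /=.
rewrite /alt_d free_mapE big_ord_recl expr0 scale1r /= free_mapE nerve_cone_face0.
congr (_ + _); rewrite (linear_sum (cone_map n)) -sumrN; apply: eq_bigr => i _ /=.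
rewrite exprS mulN1r scaleNr !free_mapE (linearZ_LR (cone_map n)) /=.
by rewrite free_mapE -nerve_cone_faceS.
Qed.

Lemma nerve_d_cone0 (x : nerve_mod k 0 X) :
  nerve_d 0 X (cone_map 0 x) = x - scale_at (free_gen (existT _ und_idc tt)) (nerve_aug X x).
Proof.
apply: (@free_hom_ext k _ _ (nerve_d 0 X \o cone_map 0)
  (idfun \- (scale_at (free_gen (existT _ und_idc tt)) \o nerve_aug X))) => -[a []] /=.
rewrite /alt_d free_mapE !big_ord_recl big_ord0 expr0 expr1 scale1r /= !free_mapE.
by rewrite free_recE /scale_at scale1r scaleN1r addr0.
Qed.
End Cone.

(** [k[N_n(- \ C)]] is free: a chain under [X] is an arbitrary chain of [C] together
    with an arrow from [X] to its first vertex. *)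
Section Free.

Definition under_forget (X : C) : functor (under_cat X) C :=
  @Functor (under_cat X) C (fun a => und_cod a) (fun a b g => sval g)
    (fun a => erefl) (fun a b c g f => erefl).

(** The objects of a chain under [X] are determined by its underlying chain of [C] and by
    its first arrow. *)
Fixpoint under_chain (X : C) n : forall a : under_cat X, chain n (und_cod a) -> chain n a :=
  match n return forall a : under_cat X, chain n (und_cod a) -> chain n a with
  | 0 => fun _ _ => tt
  | m.+1 => fun a c => let: existT Y (g, c') := c in
      existT _ (UnderObj (g \oc und_arr a) : under_cat X)
        (exist _ g erefl, under_chain (a := UnderObj (g \oc und_arr a)) c')
  end.

Lemma under_chainK (X : C) n (a : under_cat X) (c : chain n a) :
  under_chain (chain_map (under_forget X) c) = c.
Proof.
elim: n a c => [|n IH] a; first by case.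
case=> -[Y f] [[g e] c]; case: _ / e in c *; rewrite /=.
by congr existT; congr pair; exact: IH.
Qed.

Lemma chain_map_under_chain (X : C) n (a : under_cat X) (c : chain n (und_cod a)) :
  chain_map (under_forget X) (under_chain c) = c.
Proof.
elim: n a c => [|n IH] a; first by case.
case=> Y [g c] /=; congr existT; congr pair.
exact: (IH (UnderObj (g \oc und_arr a)) c).
Qed.

Lemma chain_map_under_map (X' X : C) (h : mor X' X) n (a : under_cat X) (c : chain n a) :
  chain_map (under_forget X') (chain_map (under_map h) c) = chain_map (under_forget X) c.
Proof.
elim: n a c => [//|n IH] a [b [g c]] /=.
by congr existT; congr pair; exact: IH.
Qed.

Lemma under_nerve_ext (X : C) n Y (f f' : mor X Y) (c : @chain (under_cat X) n (UnderObj f))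
    (c' : @chain (under_cat X) n (UnderObj f')) :
  f = f' -> chain_map (under_forget X) c = chain_map (under_forget X) c' ->
  existT (fun a => chain n a) (UnderObj f : under_cat X) c = existT _ (UnderObj f') c'.
Proof.
by move=> ff'; case: _ / ff' in c' * => cc'; rewrite -(under_chainK c) cc' under_chainK.
Qed.

(** A natural transformation out of [k[N_n(- \ C)]] is the free choice of an image for
    each chain of [C], placed under its first vertex by the identity arrow. *)
Lemma nerve_mod_projective n : kprojective (@nerve_mod k C n).
Proof.
move=> A B p f p_epi.
pose e (Y : C) (c : chain n Y) : nerve (under_cat Y) n :=
  existT _ (und_idc Y) (under_chain (a := und_idc Y) c).
have pv Y c : {v | p Y v = f Y (free_gen (@e Y c))} by apply: cid; exact: p_epi.
pose g0 (X : opposite C) (s : nerve (@under_cat C X) n) : A X :=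
  let: existT a c := s in
  kmap A (und_arr a : @mor (opposite C) (und_cod a) X)
    (sval (pv _ (chain_map (under_forget X) c))).
have g0_nat (X Y : opposite C) (h : mor X Y) (x : nerve_mod k n X) :
    free_rec (@g0 Y) (kmap (nerve_mod k n) h x) = kmap A h (free_rec (@g0 X) x).
  apply: (@free_hom_ext k _ _ (free_rec (@g0 Y) \o kmap (nerve_mod k n) h)
    (kmap A h \o free_rec (@g0 X))) => -[a c] /=.
  by rewrite free_mapE !free_recE /= chain_map_under_map -kmap_comp.
exists (@KTrans k (opposite C) (nerve_mod k n) A (fun X => free_rec (@g0 X)) g0_nat) => X x.
apply: (@free_hom_ext k _ _ (p X \o free_rec (@g0 X)) (f X)) => -[a c] /=.
rewrite free_recE /= kcomp_nat (svalP (pv _ _)) -kcomp_nat /= free_mapE.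
congr (f X (free_gen _)); apply: under_nerve_ext; first exact: comp1c.
by rewrite chain_map_under_map chain_map_under_chain.
Qed.
End Free.

Lemma nerve_aug_epi : kepi nerve_aug.
Proof.
move=> X y; exists (scale_at (free_gen (existT _ (und_idc X) tt)) y).
by rewrite /scale_at linearZ_LR /= free_recE /GRing.scale /= mulr1.
Qed.

Lemma nerve_exact0 (X : opposite C) (x : nerve_mod k 0 X) :
  nerve_aug X x = 0 <-> exists y, x = nerve_d 0 X y.
Proof.
split=> [x0|[y ->]].
  by exists (cone_map X 0 x); rewrite nerve_d_cone0 x0 linear0 subr0.
apply: (@free_hom_ext k _ _ (nerve_aug X \o nerve_d 0 X) \0) => s /=.
rewrite /alt_d !big_ord_recl big_ord0 expr0 expr1 scale1r scaleN1r addr0 /= !free_mapE.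
by rewrite linearB /= !free_recE subrr.
Qed.

Lemma nerve_exact n (X : opposite C) (x : nerve_mod k n.+1 X) :
  nerve_d n X x = 0 <-> exists y, x = nerve_d n.+1 X y.
Proof.
split=> [x0|[y ->]]; last exact: (@alt_dd k (nerve_at X)).
by exists (cone_map X n.+1 x); rewrite nerve_d_coneS x0 linear0 subr0.
Qed.

Definition nerve_resolution : resolution (kconst (opposite C) k^o) :=
  @Resolution k (opposite C) _ (fun n => nerve_mod k n) nerve_d nerve_aug
    nerve_mod_projective nerve_aug_epi nerve_exact0 nerve_exact.
End NerveResolution.

(** The alternating sum may be taken before or after tensoring. *)
Lemma nerve_tensor_homology (k : comPzRingType) (C : category) (N : kfunctor k C) n :
  lmod_iso (homology (tor_complex N (nerve_resolution k)) n)
           (homology (alt_complex (nerve_tensor N)) n).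
Proof.
have dE m (x : tensC (nerve_mod k m.+1) N) :
    tensC_map N (nerve_d k m) x = @alt_d k (nerve_tensor N) m x.
  pose alt := (@alt_d k (nerve_tensor N) m : {linear nerve_tensor N m.+1 -> nerve_tensor N m}).
  apply: (@tensC_hom_ext k C _ N _ (tensC_map N (nerve_d k m)) alt) => X y z.
  rewrite tensC_mapE /= /alt_d.
  pose p : {linear nerve_mod k m X -> tensC (nerve_mod k m) N} :=
    HB.pack (fun y => pureC y z)
      (GRing.isLinear.Build k _ _ _ (fun y => pureC y z) (pureC_linearl z)).
  rewrite -[LHS]/(p _) linear_sum; apply: eq_bigr => i _.
  by rewrite linearZ /= tensC_mapE.
apply: (@complex_iso_homology k (tor_complex N (nerve_resolution k))
  (alt_complex (nerve_tensor N)) (fun m => idfun) (fun m => idfun)) => m x //.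
- exact: dE.
- exact/esym/dE.
Qed.

(** * Unique factorization, and the shift of DeltaS *)

Section Inclusion.
Context {n : nat}.

Fact smor_incl_total (S : {set 'I_n}) (i j : 'I_#|S|) :
  enum_val i = enum_val j -> i != j -> false || false.
Proof. by move=> /enum_val_inj -> /eqP. Qed.
(** Monotone injections are indexed by their images, so that the factorization of a
    morphism is unique, and not only unique up to a permutation. *)
Definition smor_incl (S : {set 'I_n}) : smor #|S| n :=
  @SMor #|S| n (fun i => enum_val i) (fun _ _ => false) (fun _ _ h => False_ind _ (notF h))
    (fun _ => erefl) (fun _ _ _ h _ => h) (@smor_incl_total S).

Lemma smor_incl_slt (S : {set 'I_n}) m (f : smor m #|S|) :
  slt (smor_comp (smor_incl S) f) =2 slt f.
Proof.
move=> i j; rewrite /= /comp_lt /=; apply/andP/idP => [[]//|ij].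
by split=> //; rewrite (slt_fib ij).
Qed.

Lemma smor_incl_inj (S : {set 'I_n}) m (e e' : epi_mor m #|S|) :
  smor_comp (smor_incl S) (sval e) = smor_comp (smor_incl S) (sval e') -> e = e'.
Proof.
move=> E; apply/epi_mor_ext/smor_ext => [i|i j].
  apply: enum_val_inj.
  by rewrite -[LHS]/(smor_comp (smor_incl S) (sval e) i) E.
by rewrite -smor_incl_slt E smor_incl_slt.
Qed.

Lemma smor_incl_image (S : {set 'I_n}) m (e : epi_mor m #|S|) :
  [set smor_comp (smor_incl S) (sval e) i | i : 'I_m] = S.
Proof.
apply/setP => j; apply/imsetP/idP => [[i _ ->]|jS]; first exact: enum_valP.
have [i ei] := svalP e (enum_rank_in jS j).
by exists i => //=; rewrite ei enum_rankK_in.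
Qed.

Section Factor.
Context {m : nat} (f : smor m n).
Let S := [set f i | i : 'I_m].
Let fS i : f i \in S. Proof. exact: imset_f. Qed.
Let e (i : 'I_m) : 'I_#|S| := enum_rank_in (fS i) (f i).
Let eK i : enum_val (e i) = f i. Proof. exact: enum_rankK_in. Qed.
Fact smor_factor_fib i j : slt f i j -> e i = e j.
Proof. by move=> /slt_fib fij; apply: enum_val_inj; rewrite !eK. Qed.
Fact smor_factor_total i j : e i = e j -> i != j -> slt f i j || slt f j i.
Proof. by move=> eij; apply: slt_total; rewrite -!eK eij. Qed.
Let em : smor m #|S| :=
  SMor smor_factor_fib (@slt_irr _ _ f) (@slt_trans _ _ f) smor_factor_total.
Fact smor_factor_epi : sepi em.
Proof.
move=> j; have /imsetP[i _ ji] := enum_valP j; exists i.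
by apply: enum_val_inj; rewrite eK ji.
Qed.

(** The fibers of a monotone injection have at most one element, hence the epimorphism
    carries all of the orderings. *)
Lemma smor_factor :
  exists (T : {set 'I_n}) (g : epi_mor m #|T|), f = smor_comp (smor_incl T) (sval g).
Proof.
exists S, (exist _ em smor_factor_epi); apply: smor_ext => [i|i j] /=; first by rewrite eK.
by rewrite -[RHS]/(slt (smor_comp (smor_incl S) em) i j) smor_incl_slt.
Qed.
End Factor.

Lemma fiber_incl_in (S : {set 'I_n}) (i : 'I_#|S|) :
  fiber (smor_incl S) (enum_val i) = [:: i].
Proof.
symmetry; apply: fiber_unique => // j.
by rewrite inE /= (inj_eq enum_val_inj).
Qed.

Lemma fiber_incl_notin (S : {set 'I_n}) (j : 'I_n) :
  j \notin S -> fiber (smor_incl S) j = [::].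
Proof.
move=> jS; symmetry; apply: fiber_unique => // i; rewrite in_nil /=.
by symmetry; apply: contraNF jS => /eqP <-; exact: enum_valP.
Qed.
End Inclusion.

(** The shift [X |-> [0] + X]. The natural maps [X -> [0] + X] ([shift_unit]) and
    [[0] -> [0] + X] ([shift_point]) contract [DeltaS] to the object [[0]]. *)
Section Shift.

Section Def.
Context {n m : nat} (f : smor n m).
Let sh (i : 'I_n.+1) : 'I_m.+1 :=
  if unlift ord0 i is Some i' then lift ord0 (f i') else ord0.
Let lt (i j : 'I_n.+1) : bool :=
  match unlift ord0 i, unlift ord0 j with
  | Some i', Some j' => slt f i' j'
  | _, _ => false
  end.
Fact shift_fib i j : lt i j -> sh i = sh j.
Proof.
by rewrite /lt /sh; case: (unlift ord0 i) => [i'|] //; case: (unlift ord0 j) => [j'|] // /slt_fib ->.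
Qed.
Fact shift_irr : irreflexive lt.
Proof. by move=> i; rewrite /lt; case: (unlift ord0 i) => [i'|] //; rewrite slt_irr. Qed.
Fact shift_trans : transitive lt.
Proof.
move=> j i l; rewrite /lt; case: (unlift ord0 i) => [i'|] //; case: (unlift ord0 j) => [j'|] //.
by case: (unlift ord0 l) => [l'|] //; exact: slt_trans.
Qed.
Fact shift_total i j : sh i = sh j -> i != j -> lt i j || lt j i.
Proof.
rewrite /lt /sh; case: (unliftP ord0 i) => [i'|] -> //; case: (unliftP ord0 j) => [j'|] -> //.
by move=> /lift_inj fij ij; apply: slt_total => //; apply: contra ij => /eqP ->.
Qed.
Definition shift : smor n.+1 m.+1 := SMor shift_fib shift_irr shift_trans shift_total.
End Def.

Lemma shift_id n : shift (smor_id n) = smor_id n.+1.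
Proof.
apply: smor_ext => [i|i j] /=; first by case: (unliftP ord0 i) => [i'|] ->.
by case: unlift => // i'; case: unlift.
Qed.

Lemma shift_comp n m p (g : smor m p) (f : smor n m) :
  shift (smor_comp g f) = smor_comp (shift g) (shift f).
Proof.
apply: smor_ext => [i|i j] /=.
  by case: (unliftP ord0 i) => [i'|] _; rewrite ?liftK ?unlift_none.
rewrite /comp_lt /=; case: (unliftP ord0 i) => [i'|] _; last by rewrite unlift_none andbF.
by case: (unliftP ord0 j) => [j'|] _; rewrite ?liftK ?unlift_none ?andbF.
Qed.

Fact shift_unit_total n (i j : 'I_n) : lift ord0 i = lift ord0 j -> i != j -> false || false.
Proof. by move=> /lift_inj -> /eqP. Qed.
Definition shift_unit n : smor n n.+1 :=
  @SMor n n.+1 (lift ord0) (fun _ _ => false) (fun _ _ h => False_ind _ (notF h))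
    (fun _ => erefl) (fun _ _ _ h _ => h) (@shift_unit_total n).

Fact shift_point_total n (i j : 'I_1) : ord0 = ord0 :> 'I_n.+1 -> i != j -> false || false.
Proof. by move=> _; rewrite !ord1. Qed.
Definition shift_point n : smor 1 n.+1 :=
  @SMor 1 n.+1 (fun _ => ord0) (fun _ _ => false) (fun _ _ h => False_ind _ (notF h))
    (fun _ => erefl) (fun _ _ _ h _ => h) (@shift_point_total n).

Lemma shift_unit_nat n m (f : smor n m) :
  smor_comp (shift f) (shift_unit n) = smor_comp (shift_unit m) f.
Proof.
apply: smor_ext => [i|i j] /=; first by rewrite liftK.
rewrite /comp_lt /= !liftK andbF orbF; apply/idP/andP => [ij|[]//].
by rewrite (slt_fib ij).
Qed.

Lemma shift_point_nat n m (f : smor n m) :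
  smor_comp (shift f) (shift_point n) = shift_point m.
Proof.
by apply: smor_ext => [i|i j] /=; rewrite /comp_lt /= ?unlift_none ?andbF.
Qed.
End Shift.

Definition smor_init m : smor 0 m.
Proof.
by exists (fun i : 'I_0 => False_rect 'I_m (notF (ltn_ord i))) (fun _ _ => false) => // -[].
Defined.

Lemma smor0_eq m (f g : smor 0 m) : f = g.
Proof. by apply: smor_ext; case. Qed.

(** * Tensor powers of an augmented algebra as a Kan extension *)

Lemma tpure_zero (k : comPzRingType) (V : lmodType k) n (x : 'I_n -> V) i :
  x i = 0 -> tpure x = 0.
Proof.
move=> xi; have := @tpure_multilinear k V n i (-1) x x x.
by rewrite xi scaler0 addr0 scaleN1r addNr; apply.
Qed.

Section KanExtension.
Context {k : comPzRingType} {A : algType k}.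
Variable eps : {lrmorphism A -> k | *%R}.
Let I : lmodType k := aug_ideal eps.

Section Action.
Context {m n : nat} (f : smor m n).

Fact barIA_multilinear :
  multilinear (fun a : 'I_m -> I => tpure (fprod f (fun i => val (a i)))).
Proof.
move=> i c x y z xyz xi; apply: (bar_multilinear f (i := i)); last by rewrite xi.
by move=> j /xyz[-> ->].
Qed.
Definition barIA_map : {linear tpow I m -> tpow A n} := tpow_rec barIA_multilinear.
Lemma barIA_mapE a : barIA_map (tpure a) = tpure (fprod f (fun i => val (a i))).
Proof. exact: tpow_recE. Qed.
End Action.

Lemma barIA_map_epi m l n (f : smor l n) (e : epi_mor m l) z :
  barIA_map (smor_comp f (sval e)) z = barIA_map f (barI_map eps e z).
Proof.
apply: (@tpow_hom_ext k _ _ _ (barIA_map (smor_comp f (sval e)))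
  (barIA_map f \o barI_map eps e)) => a /=.
by rewrite barI_mapE !barIA_mapE fprod_comp.
Qed.

Lemma bar_map_barIA m l n (g : smor l n) (f : smor m l) z :
  bar_map A g (barIA_map f z) = barIA_map (smor_comp g f) z.
Proof.
apply: (@tpow_hom_ext k _ _ _ (bar_map A g \o barIA_map f)
  (barIA_map (smor_comp g f))) => a /=.
by rewrite !barIA_mapE bar_mapE fprod_comp.
Qed.

Fact aug_part_subproof (a : A) : kerP eps (a - eps a *: 1).
Proof.
by apply/eqP; rewrite linearB linearZ_LR /= rmorph1 mulr1 subrr.
Qed.
Definition aug_part (a : A) : I := exist _ (a - eps a *: 1) (aug_part_subproof a).

Lemma aug_part_linear c (x y : A) : aug_part (c *: x + y) = c *: aug_part x + aug_part y.
Proof.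
apply: val_inj.
rewrite /= (linearD eps) (linearZ_LR eps) /= scalerDl -scalerA scalerBr opprD.
by rewrite addrACA.
Qed.

Lemma aug_part_val (a : I) : aug_part (val a) = a.
Proof. by apply: val_inj; rewrite /= (kermodP a) scale0r subr0. Qed.

Lemma aug_part1 : aug_part 1 = 0.
Proof. by apply: val_inj; rewrite /= rmorph1 scale1r subrr. Qed.

Section Universal.
Context {n : nat} {W : lmodType k}.

Lemma barIA_inclE (S : {set 'I_n}) (z : 'I_#|S| -> I) :
  (forall i, fprod (smor_incl S) (fun j => val (z j)) (enum_val i) = val (z i)) /\
  (forall j, j \notin S -> fprod (smor_incl S) (fun j => val (z j)) j = 1).
Proof.
split=> [i|j jS]; rewrite /fprod; first by rewrite fiber_incl_in big_seq1.
by rewrite fiber_incl_notin // big_nil.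
Qed.

(** The tensor power of [A] is spanned by the images of tensors over [I]: a coordinate
    that is neither in [I] nor equal to [1] is split as [eps a *: 1 + (a - eps a *: 1)],
    one coordinate at a time. A tensor all of whose coordinates are in [I] or
    equal to [1] comes from the inclusion of the coordinates that are in [I]. *)
Lemma barIA_hom_ext (b b' : {linear tpow A n -> W}) :
  (forall m (f : smor m n) z, b (barIA_map f z) = b' (barIA_map f z)) -> b =1 b'.
Proof.
move=> bb'; apply: tpow_hom_ext => a.
suff H : forall l (a : 'I_n -> A),
    (forall i : 'I_n, (l <= i)%N -> eps (a i) = 0 \/ a i = 1) -> b (tpure a) = b' (tpure a).
  by apply: (H n) => i; rewrite leqNgt ltn_ord.
elim=> [|l IH] {}a aP.
  pose S := [set i | eps (a i) == 0].
  pose z (i : 'I_#|S|) := aug_part (a (enum_val i)).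
  suff -> : tpure a = barIA_map (smor_incl S) (tpure z) by exact: bb'.
  rewrite barIA_mapE; congr tpure; apply: functional_extensionality_dep => i.
  have [zin zout] := barIA_inclE z.
  case: (boolP (i \in S)) => iS.
    rewrite -(enum_rankK_in iS iS) zin /z /= (enum_rankK_in iS iS).
    by move: iS; rewrite inE => /eqP ->; rewrite scale0r subr0.
  rewrite zout //; case: (aP i (leq0n i)) => // ai.
  by rewrite inE ai eqxx in iS.
case: (ltnP l n) => [ln|nl]; last first.
  by apply: IH => i li; have := leq_ltn_trans li (ltn_ord i); rewrite ltnNge nl.
pose i := Ordinal ln.
pose y (j : 'I_n) : A := if j == i then 1 else a j.
pose z (j : 'I_n) : A := if j == i then val (aug_part (a i)) else a j.
have yz : forall j, j != i -> a j = y j /\ a j = z j.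
  by move=> j ji; rewrite /y /z (negbTE ji).
have ai : a i = eps (a i) *: y i + z i by rewrite /y /z eqxx addrC /= subrK.
have le_l (w : 'I_n -> A) : (forall j, j != i -> a j = w j) ->
    eps (w i) = 0 \/ w i = 1 -> b (tpure w) = b' (tpure w).
  move=> aw wi; apply: IH => j lj; case: (eqVneq j i) => [-> //|ji].
  rewrite -aw //; apply: aP; rewrite ltn_neqAle lj andbT.
  by apply: contra ji => /eqP lj'; apply/eqP/val_inj.
rewrite (tpure_multilinear yz ai) !linearP le_l ?le_l //.
- by move=> j /yz[].
- by left; rewrite /z eqxx; exact: kermodP.
- by move=> j /yz[].
- by right; rewrite /y eqxx.
Qed.

Variable beta : forall m, smor m n -> {linear tpow I m -> W}.
Hypothesis beta_epi : forall m l (f : smor l n) (e : epi_mor m l) z,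
  beta (smor_comp f (sval e)) z = beta f (barI_map eps e z).

(** The component of [a] in the summand of [S], when each [a i] is expanded as
    [eps (a i) *: 1 + aug_part (a i)]. *)
Let term (S : {set 'I_n}) (a : 'I_n -> A) : W :=
  (\prod_(i | i \notin S) eps (a i)) *:
  beta (smor_incl S) (tpure (fun j => aug_part (a (enum_val j)))).

Fact lan_multilinear : multilinear (fun a : 'I_n -> A => \sum_(S : {set 'I_n}) term S a).
Proof.
move=> i c x y z xyz xi; rewrite scaler_sumr -big_split; apply: eq_bigr => S _ /=.
rewrite /term; case: (boolP (i \in S)) => iS.
  have E (w : 'I_n -> A) : (forall j, j != i -> x j = w j) ->
      \prod_(j | j \notin S) eps (x j) = \prod_(j | j \notin S) eps (w j).
    by move=> xw; apply: eq_bigr => j jS; rewrite xw //; apply: contraNneq jS => ->.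
  rewrite -(E y) -?(E z); try by move=> j /xyz[].
  rewrite scalerA mulrC -scalerA -scalerDr; congr (_ *: _); rewrite -linearP.
  congr (beta _ _); apply: (tpure_multilinear (i := enum_rank_in iS i)) => [j jr|].
    have /xyz[-> ->] : enum_val j != i; last by [].
    by apply: contra jr => /eqP ji; apply/eqP/enum_val_inj; rewrite enum_rankK_in.
  by rewrite enum_rankK_in // xi aug_part_linear.
have E (w : 'I_n -> A) : (forall j, j != i -> x j = w j) ->
    (fun j => aug_part (x (enum_val j))) = (fun j : 'I_#|S| => aug_part (w (enum_val j))).
  move=> xw; apply: functional_extensionality_dep => j; rewrite xw //.
  by apply: contraNneq iS => <-; exact: enum_valP.
rewrite -(E y) -?(E z); try by move=> j /xyz[].
rewrite scalerA -scalerDl; congr (_ *: _).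
have D (w : 'I_n -> A) : (forall j, j != i -> x j = w j) ->
    \prod_(j | j \notin S) eps (w j) =
    eps (w i) * \prod_(j | (j \notin S) && (j != i)) eps (x j).
  by move=> xw; rewrite (bigD1 i) //=; congr (_ * _); apply: eq_bigr => j /andP[_ /xw ->].
rewrite (D x) // (D y) ?(D z); try by move=> j /xyz[].
by rewrite xi linearD linearZ_LR /= mulrDl mulrA.
Qed.

Definition lan_rec : {linear tpow A n -> W} := tpow_rec lan_multilinear.

(** A tensor that comes from the summand of [S] has no component at [T <> S]: an index of
    [S] outside [T] contributes a factor [eps] of an element of [I], and an index of [T]
    outside [S] contributes the augmentation part of [1]; both vanish. *)
Lemma lan_rec_incl (S : {set 'I_n}) z :
  lan_rec (barIA_map (smor_incl S) z) = beta (smor_incl S) z.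
Proof.
apply: (@tpow_hom_ext k _ _ _ (lan_rec \o barIA_map (smor_incl S))
  (beta (smor_incl S))) => {}z /=.
have [zin zout] := barIA_inclE z.
rewrite barIA_mapE /lan_rec tpow_recE (bigD1 S) //= big1 ?addr0 => [|T TS].
  rewrite /term big1 ?scale1r => [|i iS]; last by rewrite zout // rmorph1.
  congr (beta _ (tpure _)); apply: functional_extensionality_dep => j.
  by rewrite zin aug_part_val.
have : ~~ (S \subset T) || ~~ (T \subset S).
  by rewrite -negb_and; apply: contra TS => /andP[ST TS]; rewrite eqEsubset TS ST.
rewrite /term => /orP[] /subsetPn[i iS iT].
  rewrite (bigD1 i) //= -(enum_rankK_in iS iS) zin.
  have -> : eps (val (z (enum_rank_in iS i))) = 0 by exact: kermodP.
  by rewrite mul0r scale0r.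
rewrite (@tpure_zero k I _ _ (enum_rank_in iS i)) ?linear0 ?scaler0 //.
by rewrite enum_rankK_in // zout // aug_part1.
Qed.

Lemma lan_recE m (f : smor m n) z : lan_rec (barIA_map f z) = beta f z.
Proof.
by have [S [e ->]] := smor_factor f; rewrite barIA_map_epi beta_epi lan_rec_incl.
Qed.
End Universal.
End KanExtension.

(** * Extension of functors from DeltaS to the empty set *)

Section Extension.
Context {k : comPzRingType}.

Section SmorLin.
Variable m : nat.
Fact smor_lin_id (X : DeltaS) (x : freemod k (smor m X.+1)) :
  free_map (fun f => smor_comp (idc X : smor X.+1 X.+1) f) x = x.
Proof.
apply: (@free_hom_ext k _ _ (free_map (fun f => smor_comp (smor_id X.+1) f)) idfun) => f.
by rewrite free_mapE smor_comp1.
Qed.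
Fact smor_lin_comp (X Y Z : DeltaS) (g : mor Y Z) (f : mor X Y)
    (x : freemod k (smor m X.+1)) :
  free_map (fun h => smor_comp (g \oc f : smor X.+1 Z.+1) h) x =
  free_map (fun h => smor_comp (g : smor Y.+1 Z.+1) h)
    (free_map (fun h => smor_comp (f : smor X.+1 Y.+1) h) x).
Proof.
apply: (@free_hom_ext k _ _ (free_map (fun h => smor_comp (g \oc f : smor X.+1 Z.+1) h))
  (free_map (fun h => smor_comp (g : smor Y.+1 Z.+1) h) \o
   free_map (fun h => smor_comp (f : smor X.+1 Y.+1) h))) => h.
by rewrite /= !free_mapE smor_compA.
Qed.

(** The functor [X |-> k[mor(m, X)]], where [m] may be the empty set. *)
Definition smor_lin : kfunctor k DeltaS :=
  @KFunctor k DeltaS (fun X => freemod k (smor m X.+1))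
    (fun X Y g => free_map (fun f => smor_comp (g : smor X.+1 Y.+1) f))
    smor_lin_id smor_lin_comp.
End SmorLin.

Section Pairing.
Context {P : kfunctor k (opposite DeltaS)} {m : nat}.

Definition ext_pair (X : DeltaS) (p : P X) (f : smor m X.+1) : tensC P (smor_lin m) :=
  pureC (N := smor_lin m) p (free_gen f).

Lemma ext_pair_linear X (f : smor m X.+1) : linear (fun p : P X => ext_pair p f).
Proof. exact: (pureC_linearl (N := smor_lin m) (free_gen f)). Qed.

Lemma ext_pair_bal (X Y : DeltaS) (g : mor X Y) (p : P Y) (f : smor m X.+1) :
  ext_pair p (smor_comp (g : smor X.+1 Y.+1) f) =
  ext_pair (kmap P (g : @mor (opposite DeltaS) Y X) p) f.
Proof. by rewrite /ext_pair -pureC_bal /= free_mapE. Qed.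

Lemma ext_hom_ext (W : lmodType k) (F G : {linear tensC P (smor_lin m) -> W}) :
  (forall X (p : P X) (f : smor m X.+1), F (ext_pair p f) = G (ext_pair p f)) -> F =1 G.
Proof.
move=> FG; apply: tensC_hom_ext => X p.
pose r : {linear smor_lin m X -> tensC P (smor_lin m)} :=
  HB.pack (fun x => pureC p x) (GRing.isLinear.Build k _ _ _ _ (pureC_linearr p)).
apply: (@free_hom_ext k _ _ (F \o r) (G \o r)) => f; exact: FG.
Qed.

Section Rec.
Context {W : lmodType k} (b : forall X : DeltaS, P X -> smor m X.+1 -> W).
Hypothesis bl : forall X f, linear (fun p : P X => b p f).
Hypothesis bb : forall (X Y : DeltaS) (g : mor X Y) (p : P Y) (f : smor m X.+1),
  b p (smor_comp (g : smor X.+1 Y.+1) f) = b (kmap P (g : @mor (opposite DeltaS) Y X) p) f.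
Let c (X : DeltaS) (p : P X) (x : smor_lin m X) : W := free_rec (fun f => b p f) x.
Fact ext_rec_linearl X (x : smor_lin m X) : linear (fun p : P X => c p x).
Proof.
move=> a p p'; rewrite /c.
apply: (@free_hom_ext k _ _ (free_rec (fun f => b (a *: p + p') f))
  (a \*: free_rec (fun f => b p f) \+ free_rec (fun f => b p' f))) => f /=.
by rewrite !free_recE bl.
Qed.
Fact ext_rec_linearr X (p : P X) : linear (@c X p).
Proof. by move=> a x y; rewrite /c linearP. Qed.
Fact ext_rec_bal (X Y : DeltaS) (g : mor X Y) (p : P Y) (x : smor_lin m X) :
  c p (kmap (smor_lin m) g x) = c (kmap P (g : @mor (opposite DeltaS) Y X) p) x.
Proof.
apply: (@free_hom_ext k _ _ (free_rec (fun f => b p f) \o kmap (smor_lin m) g)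
  (free_rec (fun f => b (kmap P (g : @mor (opposite DeltaS) Y X) p) f))) => f /=.
by rewrite free_mapE !free_recE bb.
Qed.
Definition ext_rec : {linear tensC P (smor_lin m) -> W} :=
  tensC_rec ext_rec_linearl ext_rec_linearr ext_rec_bal.
Lemma ext_recE X (p : P X) f : ext_rec (ext_pair p f) = b p f.
Proof. by rewrite /ext_rec /ext_pair tensC_recE /c free_recE. Qed.
End Rec.
End Pairing.

Section ExtFunctor.
Variable P : kfunctor k (opposite DeltaS).

Section Map.
Context {l m : nat} (e : epi_mor m l).
Fact ext_map_bal (X Y : DeltaS) (g : mor X Y) (p : P Y) (f : smor l X.+1) :
  ext_pair p (smor_comp (smor_comp (g : smor X.+1 Y.+1) f) (sval e)) =
  ext_pair (kmap P (g : @mor (opposite DeltaS) Y X) p) (smor_comp f (sval e)).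
Proof. by rewrite -ext_pair_bal smor_compA. Qed.
Definition ext_map : {linear tensC P (smor_lin l) -> tensC P (smor_lin m)} :=
  ext_rec (fun X f => ext_pair_linear (smor_comp f (sval e))) ext_map_bal.
Lemma ext_mapE X (p : P X) f : ext_map (ext_pair p f) = ext_pair p (smor_comp f (sval e)).
Proof. exact: ext_recE. Qed.
End Map.

Fact ext_map_id m x : ext_map (epi_id m) x = x.
Proof.
by apply: (@ext_hom_ext _ _ _ (ext_map (epi_id m)) idfun) => X p f; rewrite ext_mapE smor_1comp.
Qed.
Fact ext_map_comp l m n (e : epi_mor m l) (e' : epi_mor n m) x :
  ext_map (epi_comp e e') x = ext_map e' (ext_map e x).
Proof.
apply: (@ext_hom_ext _ _ _ (ext_map (epi_comp e e')) (ext_map e' \o ext_map e)) => X p f /=.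
by rewrite !ext_mapE smor_compA.
Qed.

(** At [m] this is the tensor product over [DeltaS] with [k[mor(m, -)]]: the left Kan
    extension to the empty set, restricted to the epimorphisms. *)
Definition extf : kfunctor k (opposite EpiDeltaSplus) :=
  @KFunctor k (opposite EpiDeltaSplus) (fun m => tensC P (smor_lin m))
    (fun l m e => @ext_map l m e) ext_map_id
    (fun l m n e' e => @ext_map_comp l m n e e').
End ExtFunctor.

Lemma tensC_map_ext (P P' : kfunctor k (opposite DeltaS)) (phi : ktrans P P') m
    (X : DeltaS) (p : P X) (f : smor m X.+1) :
  tensC_map (smor_lin m) phi (ext_pair p f) = ext_pair (phi X p) f.
Proof. exact: tensC_mapE. Qed.

Fact ext_trans_nat (P P' : kfunctor k (opposite DeltaS)) (phi : ktrans P P')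
    (l m : opposite EpiDeltaSplus) (e : mor l m) (x : extf P l) :
  tensC_map (smor_lin m) phi (kmap (extf P) e x) =
  kmap (extf P') e (tensC_map (smor_lin l) phi x).
Proof.
apply: (@ext_hom_ext _ _ _ (tensC_map (smor_lin m) phi \o kmap (extf P) e)
  (kmap (extf P') e \o tensC_map (smor_lin l) phi)) => X p f /=.
by rewrite ext_mapE !tensC_map_ext ext_mapE.
Qed.
Definition ext_trans (P P' : kfunctor k (opposite DeltaS)) (phi : ktrans P P') :
  ktrans (extf P) (extf P') :=
  @KTrans k (opposite EpiDeltaSplus) (extf P) (extf P')
    (fun m => tensC_map (smor_lin m) phi) (@ext_trans_nat P P' phi).

(** [cover M] is a sum of functors [k[mor(-, Y)]]. Its extension is the sum of the same
    functors over all of the objects, and restricted to the epimorphisms [k[mor(-, Y)]]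
    is the sum over the subsets [T] of [Y] of the functors represented by [T]. So a
    natural transformation is freely determined by the images [pv Y w T] of the
    inclusions [smor_incl T]. *)
Lemma extf_cover_projective (M : kfunctor k (opposite DeltaS)) :
  kprojective (extf (cover M)).
Proof.
move=> A B p f p_epi.
pose e0 (Y : DeltaS) (w : M Y) : cover M Y :=
  free_gen (existT _ Y (@idc (opposite DeltaS) Y, w)).
have pv (Y : DeltaS) (w : M Y) (S : {set 'I_Y.+1}) :
    {v : A #|S| | p #|S| v = f #|S| (ext_pair (e0 Y w) (smor_incl S))}.
  by apply: cid; exact: p_epi.
have fac m (Y : DeltaS) (phi : smor m Y.+1) :
    {S : {set 'I_Y.+1} & {e : epi_mor m #|S| | phi = smor_comp (smor_incl S) (sval e)}}.
  by have /cid[S /cid[e ?]] := smor_factor phi; exists S, e.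
pose a (Y : DeltaS) (w : M Y) m (phi : smor m Y.+1) : A m :=
  let: existT T e := fac m Y phi in
  kmap A (sval e : @mor (opposite EpiDeltaSplus) #|T| m) (sval (pv Y w T)).
have aE (Y : DeltaS) (w : M Y) m (S : {set 'I_Y.+1}) (e : epi_mor m #|S|) :
    a Y w m (smor_comp (smor_incl S) (sval e)) =
    kmap A (e : @mor (opposite EpiDeltaSplus) #|S| m) (sval (pv Y w S)).
  rewrite /a; case: (fac _ _ _) => T [e' E] /=.
  have TS : T = S by rewrite -(smor_incl_image e') -E smor_incl_image.
  by subst T; rewrite (smor_incl_inj E).
have a_epi (Y : DeltaS) (w : M Y) m l (phi : smor l Y.+1) (e : epi_mor m l) :
    a Y w m (smor_comp phi (sval e)) =
    kmap A (e : @mor (opposite EpiDeltaSplus) l m) (a Y w l phi).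
  have [S [e' ->]] := smor_factor phi.
  by rewrite aE -kmap_comp -smor_compA -[smor_comp (sval e') _]/(sval (epi_comp e' e)) aE.
pose b0 m (X : DeltaS) (phi : smor m X.+1) (t : cover_gen M X) : A m :=
  let: existT Y (h, w) := t in a Y w m (smor_comp (h : smor X.+1 Y.+1) phi).
pose b m (X : DeltaS) (t : cover M X) (phi : smor m X.+1) : A m := free_rec (b0 m X phi) t.
have bl m X phi : linear (fun t => b m X t phi) by move=> c x y; rewrite /b linearP.
have bb m (X Y : DeltaS) (g : mor X Y) (t : cover M Y) (phi : smor m X.+1) :
    b m Y t (smor_comp (g : smor X.+1 Y.+1) phi) =
    b m X (kmap (cover M) (g : @mor (opposite DeltaS) Y X) t) phi.
  apply: (@free_hom_ext k _ _ (free_rec (b0 m Y _))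
    (free_rec (b0 m X phi) \o kmap (cover M) (g : @mor (opposite DeltaS) Y X))) => -[Z [h w]] /=.
  by rewrite free_mapE !free_recE /= smor_compA.
pose G m : {linear extf (cover M) m -> A m} := ext_rec (bl m) (bb m).
have GE m (X : DeltaS) (t : cover_gen M X) (phi : smor m X.+1) :
    G m (ext_pair (free_gen t : cover M X) phi) = b0 m X phi t.
  by rewrite /G ext_recE /b free_recE.
have cover_ext m (W : lmodType k) (F F' : {linear extf (cover M) m -> W}) :
    (forall (X : DeltaS) (t : cover_gen M X) (phi : smor m X.+1),
      F (ext_pair (free_gen t : cover M X) phi) = F' (ext_pair (free_gen t : cover M X) phi)) ->
    F =1 F'.
  move=> FF'; apply: ext_hom_ext => X t phi.
  pose r : {linear cover M X -> extf (cover M) m} :=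
    HB.pack (fun t => ext_pair t phi) (GRing.isLinear.Build k _ _ _ _ (ext_pair_linear phi)).
  apply: (@free_hom_ext k _ _ (F \o r) (F' \o r)) => {}t; exact: FF'.
have G_nat (l m : opposite EpiDeltaSplus) (e : mor l m) (x : extf (cover M) l) :
    G m (kmap (extf (cover M)) e x) = kmap A e (G l x).
  apply: (@cover_ext l _ (G m \o kmap (extf (cover M)) e) (kmap A e \o G l)) => X [Y [h w]] phi /=.
  by rewrite ext_mapE !GE /= -a_epi smor_compA.
exists (@KTrans k (opposite EpiDeltaSplus) (extf (cover M)) A G G_nat) => m x /=.
apply: (@cover_ext m _ (p m \o G m) (f m)) => X [Y [h w]] phi /=.
rewrite GE /=.
have [S [e E]] := smor_factor (smor_comp (h : smor X.+1 Y.+1) phi).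
rewrite E aE kcomp_nat (svalP (pv Y w S)) -kcomp_nat /= ext_mapE -E.
have hE : kmap (cover M) h (e0 Y w) = free_gen (existT _ Y (h, w)).
  by rewrite /e0 /= free_mapE /= smor_comp1.
by rewrite (ext_pair_bal (h : @mor DeltaS X Y)) hE.
Qed.
End Extension.

(** * Exactness of the extended resolution *)

Section ExtResolution.
Context {k : comPzRingType}.
Variable P : resolution (kconst (opposite DeltaS) (k^o : lmodType k)).
Let aug := res_aug P.

Section Augmentation.
Fact ext_aug_linear m X (f : smor m X.+1) : linear (fun p : P 0 X => aug X p).
Proof. by move=> a p p'; rewrite linearP. Qed.
Fact ext_aug_bal m (X Y : DeltaS) (g : mor X Y) (p : P 0 Y) (f : smor m X.+1) :
  aug Y p = aug X (kmap (P 0) (g : @mor (opposite DeltaS) Y X) p).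
Proof. by rewrite (kcomp_nat aug). Qed.
Definition ext_aug_at m : {linear extf (P 0) m -> k^o} :=
  ext_rec (@ext_aug_linear m) (@ext_aug_bal m).
Lemma ext_augE m X (p : P 0 X) (f : smor m X.+1) : ext_aug_at m (ext_pair p f) = aug X p.
Proof. exact: ext_recE. Qed.
Fact ext_aug_nat (l m : opposite EpiDeltaSplus) (e : mor l m) (x : extf (P 0) l) :
  ext_aug_at m (kmap (extf (P 0)) e x) = kmap (kconst (opposite EpiDeltaSplus) k^o) e (ext_aug_at l x).
Proof.
apply: (@ext_hom_ext _ _ _ _ (ext_aug_at m \o kmap (extf (P 0)) e) (ext_aug_at l)) => X p f /=.
by rewrite ext_mapE !ext_augE.
Qed.
Definition ext_aug : ktrans (extf (P 0)) (kconst (opposite EpiDeltaSplus) k^o) :=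
  @KTrans k (opposite EpiDeltaSplus) (extf (P 0)) (kconst (opposite EpiDeltaSplus) k^o)
    ext_aug_at ext_aug_nat.
End Augmentation.

Definition ext_d n : ktrans (extf (P n.+1)) (extf (P n)) := ext_trans (res_d P n).

Lemma ext_dd n m (x : extf (P n.+2) m) : ext_d n m (ext_d n.+1 m x) = 0.
Proof.
apply: (@ext_hom_ext _ _ _ _ (ext_d n m \o ext_d n.+1 m) \0) => X p f /=.
rewrite !tensC_map_ext; have -> : res_d P n X (res_d P n.+1 X p) = 0.
  by apply/res_exact; exists p.
by rewrite /ext_pair pureC0l.
Qed.

Lemma ext_aug_d m (x : extf (P 1) m) : ext_aug m (ext_d 0 m x) = 0.
Proof.
apply: (@ext_hom_ext _ _ _ _ (ext_aug m \o ext_d 0 m) \0) => X p f /=.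
rewrite !tensC_map_ext ext_augE.
have H : res_aug P X (res_d P 0 X p) = 0 by apply/res_exact0; exists p.
exact: H.
Qed.

Definition ext_cycle m n : extf (P n) m -> Prop :=
  match n return extf (P n) m -> Prop with
  | 0 => fun x => ext_aug m x = 0
  | i.+1 => fun x => ext_d i m x = 0
  end.

Definition ext_exact m := (forall y, exists x, ext_aug m x = y) /\
  forall n (x : extf (P n) m), ext_cycle x -> exists y, x = ext_d n m y.

(** The value of the extended complex at [m] is exact as soon as, up to boundaries,
    it is a retract of the exact complex [P X0] for some object [X0]. *)
Lemma ext_retract_exact m (X0 : DeltaS) (i : smor m X0.+1)
    (rho : forall n, {linear extf (P n) m -> P n X0}) :
  (forall x, aug X0 (rho 0 x) = ext_aug m x) ->
  (forall n x, res_d P n X0 (rho n.+1 x) = rho n (ext_d n m x)) ->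
  (forall n (x : extf (P n) m), ext_cycle x ->
    exists y, ext_pair (rho n x) i - x = ext_d n m y) ->
  ext_exact m.
Proof.
move=> rho_aug rho_d H; split=> [y|n x xc].
  have [q <-] := @res_epi _ _ _ P X0 y; exists (ext_pair (P := P 0) (X := X0) q i).
  exact: ext_augE.
have [y yE] := H n x xc.
have [q qE] : exists q, rho n x = res_d P n X0 q.
  case: n x xc {y yE} => [|n] x xc.
    by apply/res_exact0; rewrite -/aug rho_aug; exact: xc.
  by apply/res_exact; rewrite rho_d xc linear0.
exists (ext_pair (P := P n.+1) (X := X0) q i - y).
by rewrite linearB -yE /= tensC_map_ext -qE opprB addrC subrK.
Qed.

Section Positive.
Variable m : DeltaS.
Fact yoneda_linear n X (f : smor m.+1 X.+1) :
  linear (fun p : P n X => kmap (P n) (f : @mor (opposite DeltaS) X m) p).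
Proof. by move=> a p p'; rewrite linearP. Qed.
Fact yoneda_bal n (X Y : DeltaS) (g : mor X Y) (p : P n Y) (f : smor m.+1 X.+1) :
  kmap (P n) (smor_comp (g : smor X.+1 Y.+1) f : @mor (opposite DeltaS) Y m) p =
  kmap (P n) (f : @mor (opposite DeltaS) X m) (kmap (P n) (g : @mor (opposite DeltaS) Y X) p).
Proof. by rewrite -kmap_comp. Qed.

(** The co-Yoneda isomorphism: [[m]] is a nonempty object, so morphisms out of it in
    the category with the empty set added are morphisms of [DeltaS]. *)
Lemma ext_exact_positive : ext_exact m.+1.
Proof.
pose rho n : {linear extf (P n) m.+1 -> P n m} := ext_rec (@yoneda_linear n) (@yoneda_bal n).
have rhoE n X (p : P n X) f : rho n (ext_pair p f) = kmap (P n) (f : @mor (opposite DeltaS) X m) p.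
  exact: ext_recE.
apply: (@ext_retract_exact m.+1 m (smor_id m.+1) rho) => [x|n x|n x _].
- apply: (@ext_hom_ext _ _ _ _ (aug m \o rho 0) (ext_aug m.+1)) => X p f /=.
  by rewrite rhoE ext_augE (kcomp_nat aug).
- apply: (@ext_hom_ext _ _ _ _ (res_d P n m \o rho n.+1) (rho n \o ext_d n m.+1)) => X p f /=.
  by rewrite rhoE tensC_map_ext rhoE kcomp_nat.
- exists 0; rewrite linear0; apply/eqP; rewrite subr_eq0; apply/eqP.
  pose nu : {linear P n m -> extf (P n) m.+1} := HB.pack (fun q => ext_pair q (smor_id m.+1))
    (GRing.isLinear.Build k _ _ _ _ (ext_pair_linear (smor_id m.+1))).
  apply: (@ext_hom_ext _ _ _ _ (nu \o rho n) idfun) => X p f /=.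
  rewrite rhoE -(ext_pair_bal (f : @mor DeltaS m X)).
  by congr ext_pair; exact: smor_1comp.
Qed.
End Positive.

Section Empty.

Definition kshift (M : kfunctor k (opposite DeltaS)) : kfunctor k (opposite DeltaS).
Proof.
refine (@KFunctor k (opposite DeltaS) (fun X => M (X.+1 : DeltaS))
  (fun X Y f => kmap M (shift f : @mor (opposite DeltaS) X.+1 Y.+1)) _ _).
- by move=> X x; rewrite -[RHS](@kmap_id _ _ M) /= shift_id.
- move=> X Y Z g f x; rewrite -kmap_comp; congr (kmap M _ x); exact: shift_comp.
Defined.

Definition kshift_map (M N : kfunctor k (opposite DeltaS)) (phi : ktrans M N) :
    ktrans (kshift M) (kshift N) :=
  @KTrans k (opposite DeltaS) (kshift M) (kshift N) (fun X => phi (X.+1 : DeltaS))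
    (fun X Y f => kcomp_nat phi (shift f : @mor (opposite DeltaS) X.+1 Y.+1)).

Definition kshift_unit (M : kfunctor k (opposite DeltaS)) : ktrans (kshift M) M.
Proof.
refine (@KTrans k (opposite DeltaS) (kshift M) M
  (fun X => kmap M (shift_unit X.+1 : @mor (opposite DeltaS) X.+1 X)) _).
move=> X Y f x; rewrite -!kmap_comp; congr (kmap M _ x); exact: shift_unit_nat.
Defined.

Lemma kshift_exact (X : nat -> kfunctor k (opposite DeltaS))
    (d : forall n, ktrans (X n.+1) (X n)) :
  exact_seq d -> exact_seq (fun n => kshift_map (d n)).
Proof. by move=> ex [|n] U x; [have := ex 0 U.+1 x|have := ex n.+1 U.+1 x]. Qed.

(** A lift [phi] of the identity of [k] to the shifted resolution, followed by
    [X -> [0] + X], is homotopic to the identity. A tensor [phi p (x) f] over the empty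
    set does not depend on the morphism [f], so that [X -> [0] + X] can be traded for
    [[0] -> [0] + X]: the identity factors up to homotopy through [P [0]]. *)
Lemma ext_exact_empty : ext_exact 0.
Proof.
pose Y n := kshift (aug_obj P n).
pose f0 : ktrans (aug_obj P 0) (Y 0) :=
  @KTrans k (opposite DeltaS) (aug_obj P 0) (Y 0) (fun X => idfun) (fun _ _ _ _ => erefl).
have [phi [phi0 phid]] := chain_lift (aug_projective P) (exact_dd (aug_exact P))
  (kshift_exact (aug_exact P)) f0.
have ud n U x : aug_d P n U (ktrans_comp (kshift_unit (aug_obj P n.+1)) (phi n.+1) U x) =
    ktrans_comp (kshift_unit (aug_obj P n)) (phi n) U (aug_d P n U x).
  by rewrite /= kcomp_nat -phid.
have [h [h0 hE]] := @chain_homotopy _ _ _ _ (aug_d P) (aug_d P)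
  (aug_projective P) (exact_dd (aug_exact P)) (aug_exact P)
  (fun n => ktrans_comp (kshift_unit (aug_obj P n)) (phi n))
  (fun n => ktrans_id (aug_obj P n)) ud (fun n U x => erefl)
  (fun U x => f_equal (fun e : ktrans _ _ => e U x) phi0).
pose pt (X : DeltaS) : @mor (opposite DeltaS) X.+1 0 := shift_point X.+1.
pose r n (X : DeltaS) (p : P n X) (f : smor 0 X.+1) : P n 0 := kmap (P n) (pt X) (phi n.+1 X p).
have rl n X f : linear (fun p : P n X => r n X p f) by move=> a p p'; rewrite /r !linearP.
have rb n (X Z : DeltaS) (g : mor X Z) (p : P n Z) (f : smor 0 X.+1) :
    r n Z p (smor_comp (g : smor X.+1 Z.+1) f) =
    r n X (kmap (P n) (g : @mor (opposite DeltaS) Z X) p) f.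
  rewrite /r (kcomp_nat (phi n.+1)) -kmap_comp; congr (kmap (P n) _ _).
  exact/esym/shift_point_nat.
pose rho n : {linear extf (P n) 0 -> P n 0} := ext_rec (rl n) (rb n).
have rhoE n X (p : P n X) f : rho n (ext_pair p f) = r n X p f by exact: ext_recE.
apply: (@ext_retract_exact 0 (0 : DeltaS) (smor_init 1) rho) => [x|n x|n x xc].
- apply: (@ext_hom_ext _ _ _ _ (aug 0 \o rho 0) (ext_aug 0)) => X p f /=.
  rewrite rhoE ext_augE /r (kcomp_nat aug) /=.
  by have /= := phid 0 X p; rewrite phi0.
- apply: (@ext_hom_ext _ _ _ _ (res_d P n 0 \o rho n.+1) (rho n \o ext_d n 0)) => X p f /=.
  rewrite rhoE tensC_map_ext rhoE /r kcomp_nat; congr (kmap (P n) _ _).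
  exact: (phid n.+1 X p).
pose psi := ktrans_comp (kshift_unit (P n)) (phi n.+1).
have -> : ext_pair (rho n x) (smor_init 1) = tensC_map (smor_lin 0) psi x.
  pose nu : {linear P n 0 -> extf (P n) 0} := HB.pack (fun q => ext_pair q (smor_init 1))
    (GRing.isLinear.Build k _ _ _ _ (ext_pair_linear (smor_init 1))).
  apply: (@ext_hom_ext _ _ _ _ (nu \o rho n) (tensC_map (smor_lin 0) psi)) => X p f.
  rewrite tensC_map_ext -[LHS]/(ext_pair (rho n (ext_pair p f)) (smor_init 1)) rhoE /r /psi /=.
  rewrite -(ext_pair_bal (pt X : @mor DeltaS 0 X.+1)).
  rewrite -(ext_pair_bal (shift_unit X.+1 : @mor DeltaS X X.+1)).
  by congr ext_pair; exact: smor0_eq.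
exists (tensC_map (smor_lin 0) (h n.+1) x).
apply: (@tensC_map_homotopy _ _ _ _ _ _ _ _ _ (h n) (aug_d P n)) => [X p|].
  exact: hE.
case: n x xc @psi => [|n] x xc psi; first by apply: tensC_map0 => X p; exact: h0.
rewrite tensC_map_comp -[RHS](linear0 (tensC_map (smor_lin 0) (h n.+1))).
by congr (tensC_map _ _ _); exact: xc.
Qed.
End Empty.
End ExtResolution.

(** * Comparison of the two tensor products *)

Section ExtResolutionOf.
Context {k : comPzRingType}.
Variable P : resolution (kconst (opposite DeltaS) (k^o : lmodType k)).
Hypothesis ext_projective : forall n, kprojective (extf (P n)).

Lemma ext_exact_all m : ext_exact P m.
Proof. by case: m => [|m]; [exact: ext_exact_empty | exact: ext_exact_positive]. Qed.

Fact ext_aug_epi : kepi (ext_aug P).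
Proof. by move=> m; have [] := ext_exact_all m. Qed.

Fact ext_exact0 m x : ext_aug P m x = 0 <-> exists y, x = ext_d P 0 m y.
Proof.
split=> [x0|[y ->]]; last exact: ext_aug_d.
by have [_ ex] := ext_exact_all m; exact: (ex 0).
Qed.

Fact ext_exactS n m x : ext_d P n m x = 0 <-> exists y, x = ext_d P n.+1 m y.
Proof.
split=> [x0|[y ->]]; last exact: ext_dd.
by have [_ ex] := ext_exact_all m; exact: (ex n.+1).
Qed.

Definition ext_resolution : resolution (kconst (opposite EpiDeltaSplus) (k^o : lmodType k)) :=
  @Resolution k (opposite EpiDeltaSplus) _ (fun n => extf (P n)) (ext_d P) (ext_aug P)
    ext_projective ext_aug_epi ext_exact0 ext_exactS.
End ExtResolutionOf.

Section TensorIso.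
Context {k : comPzRingType} {A : algType k}.
Variable eps : {lrmorphism A -> k | *%R}.
Local Notation I := (aug_ideal eps).

Section Object.
Variable P : kfunctor k (opposite DeltaS).

(** The map [(p (x) f) (x) z |-> p (x) f_*(z)]. *)
Section To.
Variables (m : nat) (z : tpow I m).
Let b (X : DeltaS) (p : P X) (f : smor m X.+1) : tensC P (Bsym A) :=
  pureC (N := Bsym A) p (barIA_map eps f z).
Fact to_bar_linear X (f : smor m X.+1) : linear (fun p : P X => b p f).
Proof. exact: (pureC_linearl (N := Bsym A) (barIA_map eps f z)). Qed.
Fact to_bar_bal (X Y : DeltaS) (g : mor X Y) (p : P Y) (f : smor m X.+1) :
  b p (smor_comp (g : smor X.+1 Y.+1) f) = b (kmap P (g : @mor (opposite DeltaS) Y X) p) f.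
Proof. by rewrite /b -pureC_bal /= bar_map_barIA. Qed.
Definition to_bar_at : {linear extf P m -> tensC P (Bsym A)} :=
  ext_rec to_bar_linear to_bar_bal.
Lemma to_bar_atE X (p : P X) (f : smor m X.+1) :
  to_bar_at (ext_pair p f) = pureC (N := Bsym A) p (barIA_map eps f z).
Proof. exact: ext_recE. Qed.
End To.

Fact to_bar_linearr m (r : extf P m) : linear (fun z : BsymI eps m => to_bar_at z r).
Proof.
move=> a z z'.
apply: (@ext_hom_ext _ _ _ _ (to_bar_at (a *: z + z'))
  (a \*: to_bar_at z \+ to_bar_at z')) => X p f.
by rewrite /= !to_bar_atE linearP (pureC_linearr (N := Bsym A) p).
Qed.
Fact to_bar_epi (m l : EpiDeltaSplus) (e : mor m l) (r : extf P l) (z : BsymI eps m) :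
  to_bar_at (kmap (BsymI eps) e z) r =
  to_bar_at z (kmap (extf P) (e : @mor (opposite EpiDeltaSplus) l m) r).
Proof.
apply: (@ext_hom_ext _ _ _ _ (to_bar_at (kmap (BsymI eps) e z)) (to_bar_at z \o
  kmap (extf P) (e : @mor (opposite EpiDeltaSplus) l m))) => X p f.
by rewrite /= ext_mapE !to_bar_atE barIA_map_epi.
Qed.
Definition to_bar : {linear tensC (extf P) (BsymI eps) -> tensC P (Bsym A)} :=
  @tensC_rec k EpiDeltaSplus (extf P) (BsymI eps) _ (fun m r z => to_bar_at z r)
    (fun m z a r r' => linearP (to_bar_at z) a r r') to_bar_linearr to_bar_epi.
Lemma to_barE m X (p : P X) (f : smor m X.+1) (z : tpow I m) :
  to_bar (pureC (N := BsymI eps) (X := (m : EpiDeltaSplus)) (ext_pair p f : extf P m) z) =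
  pureC (N := Bsym A) p (barIA_map eps f z).
Proof. by rewrite /to_bar tensC_recE to_bar_atE. Qed.

(** The inverse, by the universal property of the Kan extension. *)
Section From.
Variables (X : DeltaS) (p : P X).
Let beta_fun m (f : smor m X.+1) (z : tpow I m) : tensC (extf P) (BsymI eps) :=
  pureC (N := BsymI eps) (X := (m : EpiDeltaSplus)) (ext_pair p f : extf P m) z.
Fact from_bar_linear m f : linear (@beta_fun m f).
Proof. exact: (pureC_linearr (N := BsymI eps) (X := (m : EpiDeltaSplus)) (ext_pair p f : extf P m)). Qed.
Let beta m (f : smor m X.+1) : {linear tpow I m -> tensC (extf P) (BsymI eps)} :=
  HB.pack (beta_fun f) (GRing.isLinear.Build k _ _ _ _ (from_bar_linear f)).
Fact from_bar_epi m l (f : smor l X.+1) (e : epi_mor m l) z :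
  beta (smor_comp f (sval e)) z = beta f (barI_map eps e z).
Proof.
rewrite -[RHS]/(pureC (N := BsymI eps) (X := (l : EpiDeltaSplus)) (ext_pair p f : extf P l)
  (kmap (BsymI eps) (e : @mor EpiDeltaSplus m l) z)).
by rewrite pureC_bal /= ext_mapE.
Qed.
Definition from_bar_at : {linear tpow A X.+1 -> tensC (extf P) (BsymI eps)} :=
  lan_rec beta.
Lemma from_bar_atE m (f : smor m X.+1) z :
  from_bar_at (barIA_map eps f z) =
  pureC (N := BsymI eps) (X := (m : EpiDeltaSplus)) (ext_pair p f : extf P m) z.
Proof. exact: (lan_recE from_bar_epi). Qed.
End From.

Fact from_bar_linearl X (y : Bsym A X) : linear (fun p : P X => from_bar_at p y).
Proof.
move=> a p p'; apply: (@barIA_hom_ext _ _ eps _ _ (from_bar_at (a *: p + p'))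
  (a \*: from_bar_at p \+ from_bar_at p')) => m f z.
rewrite /= !from_bar_atE ext_pair_linear.
exact: (@pureC_linearl k EpiDeltaSplus (extf P) (BsymI eps) m z a).
Qed.
Fact from_bar_bal (X Y : DeltaS) (g : mor X Y) (p : P Y) (y : Bsym A X) :
  from_bar_at p (kmap (Bsym A) g y) =
  from_bar_at (kmap P (g : @mor (opposite DeltaS) Y X) p) y.
Proof.
apply: (@barIA_hom_ext _ _ eps _ _ (from_bar_at p \o kmap (Bsym A) g)
  (from_bar_at (kmap P (g : @mor (opposite DeltaS) Y X) p))) => m f z.
by rewrite /= bar_map_barIA !from_bar_atE (ext_pair_bal (g : @mor DeltaS X Y)).
Qed.
Definition from_bar : {linear tensC P (Bsym A) -> tensC (extf P) (BsymI eps)} :=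
  @tensC_rec k DeltaS P (Bsym A) _ (fun X p y => from_bar_at p y) from_bar_linearl
    (fun X p a y y' => linearP (from_bar_at p) a y y') from_bar_bal.
Lemma from_barE m X (p : P X) (f : smor m X.+1) (z : tpow I m) :
  from_bar (pureC (N := Bsym A) p (barIA_map eps f z)) =
  pureC (N := BsymI eps) (X := (m : EpiDeltaSplus)) (ext_pair p f : extf P m) z.
Proof. by rewrite /from_bar tensC_recE from_bar_atE. Qed.

Lemma ext_tensor_hom_ext (W : lmodType k)
    (F G : {linear tensC (extf P) (BsymI eps) -> W}) :
  (forall m X (p : P X) (f : smor m X.+1) z,
    F (pureC (N := BsymI eps) (X := (m : EpiDeltaSplus)) (ext_pair p f : extf P m) z) =
    G (pureC (N := BsymI eps) (X := (m : EpiDeltaSplus)) (ext_pair p f : extf P m) z)) ->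
  F =1 G.
Proof.
move=> FG; apply: tensC_hom_ext => m r z.
pose s : {linear extf P m -> tensC (extf P) (BsymI eps)} :=
  HB.pack (fun r => pureC r z) (GRing.isLinear.Build k _ _ _ _ (pureC_linearl z)).
by apply: (@ext_hom_ext _ _ _ _ (F \o s) (G \o s)) => X p f; exact: FG.
Qed.

Lemma bar_tensor_hom_ext (W : lmodType k) (F G : {linear tensC P (Bsym A) -> W}) :
  (forall m X (p : P X) (f : smor m X.+1) (z : tpow I m),
    F (pureC (N := Bsym A) p (barIA_map eps f z)) =
    G (pureC (N := Bsym A) p (barIA_map eps f z))) ->
  F =1 G.
Proof.
move=> FG; apply: tensC_hom_ext => X p y.
pose s : {linear tpow A X.+1 -> tensC P (Bsym A)} :=
  HB.pack (fun y => pureC (N := Bsym A) p y)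
    (GRing.isLinear.Build k _ _ _ _ (pureC_linearr (N := Bsym A) p)).
by apply: (@barIA_hom_ext _ _ eps _ _ (F \o s) (G \o s)) => m f z; exact: FG.
Qed.

Lemma to_barK : cancel to_bar from_bar.
Proof.
apply: (@ext_tensor_hom_ext _ (from_bar \o to_bar) idfun) => m X p f z.
by rewrite /= to_barE from_barE.
Qed.

Lemma from_barK : cancel from_bar to_bar.
Proof.
apply: (@bar_tensor_hom_ext _ (to_bar \o from_bar) idfun) => m X p f z.
by rewrite /= from_barE to_barE.
Qed.
End Object.

(** A composite of linear maps kept folded, for the sake of unification. *)
Definition lin_comp {U V W : lmodType k} (g : {linear V -> W}) (f : {linear U -> V}) :
  {linear U -> W} := g \o f.
Lemma lin_compE (U V W : lmodType k) (g : {linear V -> W}) (f : {linear U -> V}) x :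
  lin_comp g f x = g (f x).
Proof. by []. Qed.

#[local] Opaque to_bar from_bar ext_rec ext_pair lin_comp.

(** The equations are chained by hand because rewriting has to compare the large
    structures of iterated tensor products. *)
Lemma to_bar_nat (P P' : kfunctor k (opposite DeltaS)) (phi : ktrans P P') x :
  to_bar P' (tensC_map (BsymI eps) (ext_trans phi) x) =
  tensC_map (Bsym A) phi (to_bar P x).
Proof.
have E m X (p : P X) (f : smor m X.+1) (z : tpow I m) :
    to_bar P' (tensC_map (BsymI eps) (ext_trans phi)
      (pureC (N := BsymI eps) (X := (m : EpiDeltaSplus)) (ext_pair p f : extf P m) z)) =
    tensC_map (Bsym A) phi (to_bar P
      (pureC (N := BsymI eps) (X := (m : EpiDeltaSplus)) (ext_pair p f : extf P m) z)).
  apply: etrans (f_equal (to_bar P') (@tensC_mapE k EpiDeltaSplus _ _ (BsymI eps)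
    (ext_trans phi) m (ext_pair p f) z)) _.
  apply: etrans _ (esym (f_equal (tensC_map (Bsym A) phi) (to_barE p f z))).
  apply: etrans _ (esym (@tensC_mapE k DeltaS _ _ (Bsym A) phi X p (barIA_map eps f z))).
  apply: etrans _ (to_barE (phi X p) f z).
  have extE : ext_trans phi m (ext_pair p f) = ext_pair (phi X p) f by exact: tensC_map_ext.
  by rewrite extE.
pose F := lin_comp (to_bar P') (tensC_map (BsymI eps) (ext_trans phi)).
pose G := lin_comp (tensC_map (Bsym A) phi) (to_bar P).
have FE y : F y = to_bar P' (tensC_map (BsymI eps) (ext_trans phi) y) := lin_compE _ _ _.
have GE y : G y = tensC_map (Bsym A) phi (to_bar P y) := lin_compE _ _ _.
apply: etrans (esym (FE x)) _; apply: etrans (GE x).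
refine (@ext_tensor_hom_ext P _ F G _ x) => m X p f z.
by apply: etrans (FE _) _; apply: etrans (esym (GE _)); exact: E.
Qed.

Lemma from_bar_nat (P P' : kfunctor k (opposite DeltaS)) (phi : ktrans P P') y :
  from_bar P' (tensC_map (Bsym A) phi y) =
  tensC_map (BsymI eps) (ext_trans phi) (from_bar P y).
Proof.
apply: (can_inj (to_barK (P := P'))); apply: etrans (from_barK _) _.
apply: etrans _ (esym (to_bar_nat phi (from_bar P y))).
exact: esym (f_equal (tensC_map (Bsym A) phi) (from_barK y)).
Qed.

Lemma ext_tor_iso (P : resolution (kconst (opposite DeltaS) (k^o : lmodType k)))
    (ext_proj : forall n, kprojective (extf (P n))) n :
  lmod_iso (homology (tor_complex (Bsym A) P) n)
           (homology (tor_complex (BsymI eps) (ext_resolution ext_proj)) n).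
Proof.
apply/lmod_iso_sym.
apply: (@complex_iso_homology k (tor_complex (BsymI eps) (ext_resolution ext_proj))
  (tor_complex (Bsym A) P) (fun i => to_bar (P i)) (fun i => from_bar (P i))) => i.
- exact: to_bar_nat.
- exact: from_bar_nat.
- exact: to_barK.
- exact: from_barK.
Qed.
End TensorIso.

Theorem proposition69 (k : comPzRingType) (A : algType k)
    (eps : {lrmorphism A -> k | *%R}) (n : nat) :
  lmod_iso (HS A n) (homology (alt_complex (Yepi eps)) n).
Proof.
pose P := std_resolution (kconst (opposite DeltaS) (k^o : lmodType k)).
have ext_proj i : kprojective (extf (P i)) by exact: extf_cover_projective.
apply: lmod_iso_trans (nerve_tensor_homology (BsymI eps) n).
apply: lmod_iso_trans (Tor_resolution (BsymI eps) (ext_resolution ext_proj)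
  (nerve_resolution k) n).
exact: ext_tor_iso.
Qed.
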